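(* Let $p\geq2$ and let $G$ be a $2p$-angulation of girth $2p$ with external vertices $u_1,\dots,u_{2p}$ in clockwise order, properly colored black/white with $u_1$ black. The map $\Lambda:(F_1,\dots,F_{2p})\mapsto(F_2,F_4,\dots,F_{2p})$ is a bijection from the set of even Schnyder decompositions of $G$ to the set of reduced Schnyder decompositions of $G$.
   Context: Graphs are finite, loopless, possibly with multiple edges. A plane graph is a connected planar graph with a fixed crossing-free drawing; unbounded face external, vertices/edges on it external, others internal. A $2p$-angulation is a plane graph all of whose faces have degree $2p$ (hence bipartite). Let $d=2p$; indices are taken modulo $d$ for Schnyder decompositions and modulo $p$ for reduced ones. A Schnyder decomposition of $G$ is a covering of the internal edges by $d$ oriented forests $F_1,\dots,F_d$ such that: (i) each internal edge is in exactly $d-2$ forests; (ii) $F_i$ spans all vertices except $u_i,u_{i+1}$ and consists of $d-2$ trees, each containing one $u_j$, $j\neq i,i+1$, oriented toward it; (iii) around each internal vertex $v$ the outgoing arcs of colors $1,\dots,d$ appear in clockwise order (possibly sharing edges), and with $e_i$ the edge carrying the outgoing arc of color $i$, incoming arcs of color $i$ lie strictly between $e_{i+1}$ and $e_{i-1}$ in clockwise order around $v$. It is even if every arc of every internal edge belongs to an even number of the forests. A reduced Schnyder decomposition of $G$ is a covering of the internal edges by oriented forests $F'_1,\dots,F'_p$ such that: (i') each internal edge belongs to exactly $p-1$ of them; (ii') for each $i\in[p]$, $F'_i$ spans all vertices except $u_{2i},u_{2i+1}$ and consists of $2p-2$ trees, each containing one $u_j$, $j\neq 2i,2i+1$, and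 oriented toward it; (iii') around each internal vertex $v$, the edges $e'_1,\dots,e'_p$ leading $v$ to its parent in $F'_1,\dots,F'_p$ appear in clockwise order (some may coincide), and if $v$ is black (resp. white), the incoming edges of color $i$ at $v$ lie between $e'_{i+1}$ and $e'_i$ (resp. between $e'_i$ and $e'_{i-1}$) in clockwise order around $v$ and are distinct from these edges. *)

(* Defs.v *)
From mathcomp Require Import all_boot.
From mathcomp Require Import classical_sets functions.

Set Implicit Arguments.
Unset Strict Implicit.
Unset Printing Implicit Defensive.

(* Graphs on a surface are encoded as combinatorial maps: every edge carries two
   darts (its two orientations) exchanged by [opp], and [cw a] is the next dart
   after [a] in clockwise order around the vertex [src a]. Multiple edges are
   allowed. A dart is identified both with an arc and with an edge-end at its
   source. *)
Record embedded_graph := EmbeddedGraph {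
  vertex : finType;
  dart : finType;
  src : dart -> vertex;
  opp : dart -> dart;
  cw : dart -> dart;
  oppK : involutive opp;
  opp_neq : forall a, opp a != a;
  cw_inj : injective cw;
  src_cw : forall a b, (src a == src b) = fconnect cw a b;
  src_surj : forall v, exists a, src a = v
}.

Section EmbeddedGraph.
Variable G : embedded_graph.
Implicit Types (a b x y : dart G) (A : {set dart G}) (v w : vertex G).

Definition tgt a : vertex G := src (opp a).

(* Since [cw] turns clockwise, [face a] follows [a] along the contour of the face
   lying to the left of [a]; the orbits of [face] are the faces. Walking with the
   external face on one's left goes clockwise around the graph. *)
Definition face a : dart G := cw (opp a).

Definition adj A : rel (vertex G) :=
  [rel v w | [exists a in A, (src a == v) && (tgt a == w)]].

Definition edges_of A : {set dart G} := [set a | (a \in A) || (opp a \in A)].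

(* The last condition excludes going back and forth along a single edge. *)
Definition simple_cycle (c : seq (dart G)) : bool :=
  [&& c != [::], cycle (fun a b => tgt a == src b) c, uniq (map (@src G) c)
    & all (fun a => opp a \notin c) c].

Definition has_girth (g : nat) : Prop :=
  (exists2 c, simple_cycle c & size c = g) /\
  (forall c, simple_cycle c -> g <= size c).

End EmbeddedGraph.

(* Planarity is Euler's relation #V + #F = #E + 2 for a connected map, i.e. genus
   0. The external face is the one to the left of [outer]. *)
Record plane_graph := PlaneGraph {
  plane_map :> embedded_graph;
  loopless : forall a : dart plane_map, tgt a != src a;
  connected : forall v w : vertex plane_map, connect (adj [set: dart plane_map]) v w;
  planar : #|vertex plane_map| + fcard (@face plane_map) (dart plane_map)
           = #|dart plane_map|./2 + 2;
  outer : dart plane_map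
}.

Definition angulation (d : nat) (G : plane_graph) : Prop :=
  forall a : dart G, order (@face G) a = d.

Definition proper_coloring (G : embedded_graph) (black : pred (vertex G)) : Prop :=
  forall a : dart G, black (src a) != black (tgt a).

Section PlaneGraph.
Variable G : plane_graph.
Implicit Types (a b x y : dart G) (A : {set dart G}) (v w : vertex G).

Definition external_contour : {set dart G} :=
  [set a | fconnect (@face G) (outer G) a].

Definition internal_darts : {set dart G} :=
  [set a | (a \notin external_contour) && (opp a \notin external_contour)].

Definition internal_vertices : {set vertex G} :=
  ~: [set src a | a in external_contour].

(* The sequence u_0, u_1, u_2, ... lists the external vertices clockwise. It is
   periodic: in a d-angulation, indices are residues modulo d, and u_0 = u_d. *)
Definition external_clockwise (u : nat -> vertex G) : Prop :=
  exists2 a, a \in external_contour & forall i, u i = src (iter i (@face G) a).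

(* The edge-ends x_1, ..., x_n around a vertex, some of which may coincide, are in
   clockwise order: moving clockwise from x_1 to x_2, ..., from x_(n-1) to x_n and
   from x_n back to x_1 (not moving between equal ones) makes at most one turn. *)
Definition clockwise (s : seq (dart G)) : bool :=
  if s is x :: s' then
    sumn (pairmap (findex (@cw G)) x (rcons s' x)) <= order (@cw G) x
  else true.

(* When x = y, the sector is the whole turn around the vertex from x to itself. *)
Definition strictly_between x b y : bool :=
  [&& b != x, b != y, fconnect (@cw G) x b & clockwise [:: x; b; y]].

Definition oriented_forest A : Prop :=
  (forall a, a \in A -> opp a \notin A) /\
  (forall c, simple_cycle c -> ~~ all (mem (edges_of A)) c).

(* [A] is the set of arcs of a forest spanning all the vertices except u_k and
   u_(k+1). Each spanned vertex is in the tree of exactly one u_j with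
   j != k, k+1, so that there are d-2 trees, and it has a directed path to u_j. *)
Definition spanning_forest d (u : nat -> vertex G) (k : 'I_d) A : Prop :=
  let spanned v := (v != u k) && (v != u (ordS k)) in
  let is_root (j : 'I_d) := (j != k) && (j != ordS k) in
  [/\ oriented_forest A,
      forall a, a \in A -> spanned (src a) && spanned (tgt a)
    & forall v, spanned v -> exists j : 'I_d,
        [/\ is_root j, connect (adj A) v (u j)
          & forall l : 'I_d,
              is_root l -> connect (adj (edges_of A)) v (u l) -> l = j]].

Definition out_arcs A v : {set dart G} := [set a in A | src a == v].

(* Colors are residues modulo d, represented in {0, ..., d-1}; in particular the
   color d is represented by 0. *)
Definition schnyder_decomposition d (u : nat -> vertex G)
    (F : {ffun 'I_d -> {set dart G}}) : Prop :=
  [/\ forall i, F i \subset internal_darts,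
      forall a, a \in internal_darts -> #|[set i | a \in edges_of (F i)]| = d - 2,
      forall i, spanning_forest u i (F i)
    & forall v, v \in internal_vertices -> exists e : 'I_d -> dart G,
        [/\ forall i, out_arcs (F i) v = [set e i],
            clockwise (codom e)
          & forall i a, a \in F i -> tgt a = v ->
              strictly_between (e (ordS i)) (opp a) (e (ord_pred i))]].

Definition even_decomposition d (F : {ffun 'I_d -> {set dart G}}) : Prop :=
  forall a, a \in internal_darts -> ~~ odd #|[set i | a \in F i]|.

Lemma dbl_subproof p (i : 'I_p) : i.*2 < p.*2.
Proof. by rewrite ltn_double. Qed.

Definition dbl p (i : 'I_p) : 'I_p.*2 := Ordinal (dbl_subproof i).

Definition reduced_decomposition p (u : nat -> vertex G) (black : pred (vertex G))
    (F : {ffun 'I_p -> {set dart G}}) : Prop :=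
  [/\ forall i, F i \subset internal_darts,
      forall a, a \in internal_darts -> #|[set i | a \in edges_of (F i)]| = p - 1,
      forall i, spanning_forest u (dbl i) (F i)
    & forall v, v \in internal_vertices -> exists e : 'I_p -> dart G,
        [/\ forall i, out_arcs (F i) v = [set e i],
            clockwise (codom e)
          & forall i a, a \in F i -> tgt a = v ->
              if black v then strictly_between (e (ordS i)) (opp a) (e i)
              else strictly_between (e i) (opp a) (e (ord_pred i))]].

Definition Lambda p (F : {ffun 'I_p.*2 -> {set dart G}}) :
    {ffun 'I_p -> {set dart G}} :=
  [ffun i => F (dbl i)].

End PlaneGraph.

(* Main.v *)
Require Import Defs.
From mathcomp Require Import all_boot.
From mathcomp Require Import ssralg ssrnum zmodp rat matrix mxalgebra.
From mathcomp Require Import zify.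

(* In an even Schnyder decomposition the colors of the arcs leaving an internal
   vertex come in pairs of consecutive equal arcs, and the rule at the two ends of
   an edge forces adjacent vertices to pair the colors in opposite ways. Starting
   from the external vertices, black vertices pair 2i-1 with 2i and white vertices
   pair 2i with 2i+1, so that the even colors determine the odd ones.

   Conversely, a reduced decomposition is unfolded by this pairing rule. The only
   global condition to check is that an odd color 2i+1 contains no directed cycle C.
   The local rule implies that arcs of color 2i leave C only to its right and arcs
   of color 2i+2 only to its left, while both reach the external face. This is
   impossible since C separates the plane: by Euler's relation C is a combination
   of face contours, which gives a function on the faces that jumps exactly across
   C. *)

Set Implicit Arguments.
Unset Strict Implicit.
Unset Printing Implicit Defensive.

(** * Clockwise order around a vertex *)

(** Evenness alone leaves two candidate pairings at each internal vertex. The right one is carried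
    backwards along the arcs of a single forest, starting from an external vertex, where no arc
    leaves and the pairing holds vacuously. In the other direction, an odd color of the unfolding
    follows [F (ordS i)] from black vertices and [F i] from white ones, so the acyclicity of neither
    forest excludes a cycle of the mixture. As every internal vertex has exactly one outgoing arc of
    each color, it is enough that every vertex reaches the outside; failing this, a minimal set
    closed under [parent] plays the role of the directed cycle. Separation by it is linear algebra
    over [rat], with the rank bounds given by connectedness of the graph and of its dual. The girth
    makes the external vertices distinct, hence the roots of the trees as well. *)

Section CyclicIndex.
Variables (T : finType) (f : T -> T).
Hypothesis injf : injective f.

Lemma iter_modn_order x n : iter (n %% order f x) f x = iter n f x.
Proof.
rewrite {2}(divn_eq n (order f x)) addnC iterD; congr iter.
by elim: (n %/ _) => [|m IHm] //; rewrite mulSn iterD -IHm iter_order.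
Qed.

Lemma findex_iter_mod x n : findex f x (iter n f x) = n %% order f x.
Proof. by rewrite -iter_modn_order findex_iter // ltn_mod order_gt0. Qed.

Lemma findex_add_mod x y z : fconnect f x y -> fconnect f y z ->
  findex f x z = (findex f x y + findex f y z) %% order f x.
Proof.
move=> xy yz; rewrite -findex_iter_mod addnC iterD.
by rewrite (iter_findex xy) (iter_findex yz).
Qed.

Lemma findex_triangle x y z : fconnect f x y -> fconnect f y z ->
  findex f x z <= findex f x y + findex f y z.
Proof. by move=> xy yz; rewrite (findex_add_mod xy yz) leq_mod. Qed.

Lemma order_fconnect x y : fconnect f x y -> order f y = order f x.
Proof.
move=> xy; apply: eq_card => z; rewrite !inE.
by rewrite (same_connect (fconnect_sym injf) xy).
Qed.

(** The two sides agree modulo one turn and each distance is less than a turn, so at most one turn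
    is lost. Comparisons of angles below reduce to this dichotomy, which [lia] settles. *)
Lemma findex_add_cases x y z : fconnect f x y -> fconnect f y z ->
  findex f x y + findex f y z = findex f x z \/
  findex f x y + findex f y z = findex f x z + order f x.
Proof.
move=> xy yz; have := findex_max xy; have := findex_max yz.
rewrite (order_fconnect xy) (findex_add_mod xy yz) => ltz lty.
case: (ltnP (findex f x y + findex f y z) (order f x)) => h.
  by left; rewrite modn_small.
right; rewrite -{2}(subnK h) modnDr modn_small; lia.
Qed.

Lemma findex_sym x y : fconnect f x y -> x != y ->
  findex f x y + findex f y x = order f x.
Proof.
move=> xy nxy; have yx : fconnect f y x by rewrite fconnect_sym.
have := findex_add_cases xy yx; rewrite findex0 => -[] // h.
by move: nxy; rewrite -(findex_eq0 f); lia.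
Qed.

End CyclicIndex.

Section ClosedSets.

Lemma ordS_closed_full n (P : pred 'I_n) (k : 'I_n) :
  P k -> (forall i, P i -> P (ordS i)) -> forall i, P i.
Proof.
move=> Pk PS i.
have H m (hm : (k + m) %% n < n) : P (Ordinal hm).
  elim: m hm => [|m IHm] hm.
    rewrite (_ : Ordinal _ = k) //; apply: val_inj => /=.
    by rewrite addn0 modn_small.
  have hm' : (k + m) %% n < n by rewrite ltn_mod (leq_ltn_trans _ (ltn_ord k)).
  have /PS := IHm hm'; rewrite (_ : ordS _ = Ordinal hm) //.
  by apply: val_inj; rewrite /= -addn1 modnDml -addnA addn1.
have hm : (k + (i + n - k)) %% n < n.
  by rewrite ltn_mod (leq_ltn_trans _ (ltn_ord k)).
rewrite (_ : i = Ordinal hm) //; apply: val_inj => /=.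
have -> : k + (i + n - k) = i + n by have := ltn_ord k; lia.
by rewrite modnDr modn_small.
Qed.

(** This locates a color after which an edge stops being carried by the forests. *)
Lemma ordS_boundary n (P : pred 'I_n) (k l : 'I_n) :
  P k -> ~~ P l -> exists2 i, P i & ~~ P (ordS i).
Proof.
move=> Pk nPl; case: (pickP (fun i => P i && ~~ P (ordS i))) => [i /andP[]|h].
  by exists i.
case/negP: nPl; apply: (ordS_closed_full Pk) => i Pi.
by have /negbT := h i; rewrite Pi negbK.
Qed.

End ClosedSets.

Section Clockwise.
Variable G : plane_graph.
Implicit Types (a b x y : dart G) (v : vertex G).

Local Notation ind := (findex (@cw G)).
Local Notation deg := (order (@cw G)).

Lemma fconnect_src x y v : src x = v -> src y = v -> fconnect (@cw G) x y.
Proof. by move=> hx hy; rewrite -src_cw hx hy. Qed.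

Lemma src_iter_cw n x : src (iter n (@cw G) x) = src x.
Proof. by apply/esym/eqP; rewrite src_cw fconnect_iter. Qed.

Lemma src_cw1 x : src (cw x) = src x.
Proof. exact: (src_iter_cw 1). Qed.

(** A clockwise triple makes at most one turn, and going from [x] to [y] and back is already one
    turn, so the detour through [b] cannot add another. The case [x = y] is excluded because the
    sector is then a whole turn while [findex] gives 0. *)
Lemma findex_lt_of_between x b y :
  strictly_between x b y -> x != y -> src x = src y ->
  0 < ind x b < ind x y.
Proof.
case/and4P => nbx nby xb; rewrite /clockwise /= addn0 => le_deg nxy exy.
have by_ : fconnect (@cw G) b y.
  by move: xb; rewrite -!src_cw -exy eq_sym.
have xy : fconnect (@cw G) x y by rewrite -src_cw exy.
have := findex_sym (@cw_inj G) xy nxy.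
have := findex_add_cases (@cw_inj G) xb by_.
have : ind x b != 0 by rewrite findex_eq0 eq_sym.
have : ind b y != 0 by rewrite findex_eq0.
lia.
Qed.

Lemma findex_gt_of_between x b y :
  strictly_between y b x -> x != y -> src x = src y -> ind x y < ind x b.
Proof.
case/and4P => nby nbx yb; rewrite /clockwise /= addn0 => le_deg nxy exy.
have xy : fconnect (@cw G) x y by rewrite -src_cw exy.
have xb := connect_trans xy yb.
have := findex_add_cases (@cw_inj G) xy yb.
rewrite eq_sym in nbx.
have := findex_sym (@cw_inj G) xb nbx.
rewrite (order_fconnect (@cw_inj G) xy) in le_deg.
have : ind y b != 0 by rewrite findex_eq0 eq_sym.
have := findex_max xb.
lia.
Qed.

Lemma clockwise_sum (s : seq (dart G)) x0 : s != [::] ->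
  clockwise s = (\sum_(i < size s)
    ind (nth x0 s i) (nth x0 s (i.+1 %% size s)) <= deg (nth x0 s 0)).
Proof.
case: s => // x s _; rewrite /clockwise sumnE (big_nth 0) big_mkord.
rewrite size_pairmap size_rcons /=; congr (_ <= _).
apply: eq_bigr => -[i lt_i] _ /=.
rewrite (nth_pairmap x0) ?size_rcons // -/(rcons (x :: s) x).
rewrite !nth_rcons /= lt_i.
congr (findex _ _ _); case: (ltnP i (size s)) => h.
  by rewrite modn_small.
by rewrite (_ : i = size s) ?eqxx ?modnn //; lia.
Qed.

Lemma clockwise_codom n (e : 'I_n -> dart G) v (k : 'I_n) :
  (forall i, src (e i) = v) ->
  clockwise (codom e) = (\sum_i ind (e i) (e (ordS i)) <= deg (e k)).
Proof.
move=> he; have n_gt0 : 0 < n by exact: leq_ltn_trans (ltn_ord k).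
have szc : size (codom e) = n by rewrite size_codom card_ord.
have nthc (i : 'I_n) : nth (e k) (codom e) i = e i.
  by rewrite (nth_map k) ?size_enum_ord // nth_ord_enum.
rewrite (@clockwise_sum _ (e k)); last by rewrite -size_eq0 szc -lt0n.
have /= -> := nthc (Ordinal n_gt0).
rewrite (order_fconnect (@cw_inj G) (@fconnect_src (e k) _ v _ _)) //.
congr (_ <= _); rewrite szc; apply: eq_bigr => i _.
by rewrite nthc -[e (ordS i)]nthc.
Qed.

Lemma nat_crossing (h : nat -> nat) c n : h 0 <= c < h n ->
  exists2 m, m < n & h m <= c < h m.+1.
Proof.
elim: n => [|n IHn] /andP[h0 hn]; first by lia.
case: (leqP (h n) c) => hc; first by exists n; rewrite ?hc.
by have [|m lt_m] := IHn; [rewrite h0 | exists m => //; exact: ltnW].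
Qed.

(** * Total turn of a clockwise family of arcs and parity of its breaks *)

Section Height.
Variables (n : nat) (e : 'I_n -> dart G) (v : vertex G).
Hypothesis src_e : forall i, src (e i) = v.
Hypothesis cw_e : clockwise (codom e).
Hypothesis break_e : exists i, e i != e (ordS i).

(** A lift to [nat] of the angular position of [e m], not reduced modulo the degree: colors at
    height 0 and colors at full height carry the same dart. *)
Definition height m := \sum_(i < n | i < m) ind (e i) (e (ordS i)).

Lemma heightS (k : 'I_n) : height k.+1 = height k + ind (e k) (e (ordS k)).
Proof.
rewrite /height (bigD1 k) //= addnC; congr (_ + _).
by apply: eq_bigl => i; rewrite ltnS [in RHS]ltn_neqAle andbC.
Qed.

Lemma height_mono m m' : m <= m' -> height m <= height m'.
Proof.
move=> le_m; rewrite /height big_mkcond [leqRHS]big_mkcond; apply: leq_sum => i _.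
by case: ifP => // lt_i; rewrite (leq_trans lt_i).
Qed.

Lemma height_total : height n = \sum_i ind (e i) (e (ordS i)).
Proof. by apply: eq_bigl => i; rewrite ltn_ord. Qed.

Variable k0 : 'I_n.
Hypothesis k0_eq0 : k0 = 0 :> nat.

Lemma iter_height (k : 'I_n) : iter (height k) (@cw G) (e k0) = e k.
Proof.
case: k => m; elim: m => [|m IHm] lt_m.
  rewrite /height big_pred0 //= (_ : Ordinal _ = k0) //.
  by exact: val_inj.
have lt_m' := ltnW lt_m.
rewrite [height _](heightS (Ordinal lt_m')) addnC iterD IHm.
rewrite iter_findex ?(fconnect_src (src_e _) (src_e _)) //.
by congr e; apply: val_inj; rewrite /= modn_small.
Qed.

Lemma height_le : height n <= deg (e k0).
Proof. by rewrite height_total -(clockwise_codom _ src_e). Qed.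

(** Running through all colors returns to [e k0], so the total turn is a multiple of the degree.
    Clockwise order bounds it by one degree and a break makes it positive. *)
Lemma height_full : height n = deg (e k0).
Proof.
have n_gt0 : 0 < n by exact: leq_ltn_trans (ltn_ord k0).
have lt_n1 : n.-1 < n by rewrite prednK.
have := heightS (Ordinal lt_n1); rewrite /= prednK // => hn.
have : iter (height n) (@cw G) (e k0) = e k0.
  rewrite hn addnC iterD [iter (height _) _ _](iter_height (Ordinal lt_n1)).
  rewrite iter_findex ?(fconnect_src (src_e _) (src_e _)) //.
  by congr e; apply: val_inj; rewrite /= prednK // modnn.
move/(congr1 (ind (e k0))); rewrite (findex_iter_mod (@cw_inj G)) findex0.
move/eqP; rewrite -/(dvdn _ _) => dvd_h.
have [i ne_i] := break_e.
have h_gt0 : 0 < height n.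
  have := heightS i; have := height_mono (ltn_ord i).
  by move: ne_i; rewrite -(findex_eq0 (@cw G)); lia.
by apply/eqP; rewrite eqn_leq height_le dvdn_leq.
Qed.

Lemma sector_of x : src x = v ->
  exists j, ind (e j) x < ind (e j) (e (ordS j)).
Proof.
move=> xv; have e0x := fconnect_src (src_e k0) xv.
have [|m lt_m /andP[le_h lt_h]] := @nat_crossing height (ind (e k0) x) n.
  by rewrite height_full findex_max // /height big_pred0.
pose j := Ordinal lt_m; exists j.
have lt_x := findex_max e0x.
have ex : iter (ind (e k0) x - height m) (@cw G) (e j) = x.
  by rewrite -(iter_height j) -iterD subnK // iter_findex.
have dej : deg (e j) = deg (e k0).
  exact: (order_fconnect (@cw_inj G) (fconnect_src (src_e _) (src_e _))).
rewrite -{1}ex findex_iter; last by rewrite dej; lia.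
by have := heightS j; rewrite /=; lia.
Qed.

Lemma card_even_fibers (X : {set dart G}) :
  (forall x, ~~ odd #|[set i | e i == x]|) -> ~~ odd #|[set i | e i \in X]|.
Proof.
move=> even_e; rewrite -sum1_card (partition_big e (mem X)) /=; last first.
  by move=> i; rewrite inE.
elim/big_ind: _ => // [a b|x Xx]; first by rewrite oddD => /negbTE-> /negbTE->.
rewrite (eq_bigl (mem [set i | e i == x])) ?sum1_card // => i.
by rewrite !inE; case: eqP => [->|]; rewrite ?Xx ?andbF.
Qed.

(* At a break after color [k], the colors [0, ..., k] are those of height 0
   together with a union of fibers, so the parity of [k + 1] is always the same. *)
Lemma odd_break : (forall x, ~~ odd #|[set i | e i == x]|) ->
  forall k, e k != e (ordS k) -> odd k.+1 = odd #|[set i : 'I_n | height i == 0]|.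
Proof.
move=> even_e k ne_k.
have lt_k : height k < height k.+1.
  by move: ne_k; rewrite heightS -(findex_eq0 (@cw G)); lia.
(* The shift [c.+1] leaves out [e k0], whose fiber may also contain late colors of full height; this
   is why the colors of height 0 are counted apart. *)
pose X := [set iter c.+1 (@cw G) (e k0) | c : 'I_(height k)].
have full := height_full.
have lt_kd : height k < deg (e k0).
  by rewrite -full (leq_trans lt_k) ?height_mono.
have := card_even_fibers X even_e.
have -> : [set i | e i \in X] = [set i : 'I_n | i <= k] :\: [set i : 'I_n | height i == 0].
  apply/setP=> i; rewrite !inE; apply/imsetP/andP => [[c _]|[nz_i le_ik]].
    rewrite -iter_height => eq_i.
    have lt_c := ltn_ord c.
    have := congr1 (ind (e k0)) eq_i.
    rewrite !(findex_iter_mod (@cw_inj G)) (@modn_small c.+1); last by lia.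
    have := height_mono (ltnW (ltn_ord i)); rewrite full leq_eqVlt => /orP[/eqP->|lt_i].
      by rewrite modnn.
    rewrite modn_small // => hi; split; first by rewrite hi.
    by rewrite leqNgt; apply/negP=> /height_mono; lia.
  have le_h := height_mono le_ik.
  have lt_c : (height i).-1 < height k by lia.
  by exists (Ordinal lt_c); rewrite //= -iterS prednK ?iter_height // lt0n.
rewrite cardsD (setIidPr _); last first.
  apply/subsetP=> i; rewrite !inE => /eqP h0.
  rewrite leqNgt; apply/negP=> /height_mono; rewrite h0; lia.
have le_c : #|[set i : 'I_n | height i == 0]| <= #|[set i : 'I_n | i <= k]|.
  apply: subset_leq_card; apply/subsetP=> i; rewrite !inE => /eqP h0.
  rewrite leqNgt; apply/negP=> /height_mono; rewrite h0; lia.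
rewrite oddB // negb_add => /eqP <-; congr odd.
rewrite -sum1_card (eq_bigl (fun i : 'I_n => i < k.+1)); last first.
  by move=> i; rewrite inE ltnS.
by rewrite -(big_ord_widen _ (fun _ => 1)) ?sum1_card ?card_ord.
Qed.

End Height.

(** By [odd_break] all breaks occur at indices of one parity, so no break occurs at an index of the
    other parity. *)
Lemma clockwise_pairing n (e : 'I_n -> dart G) v : (forall i, src (e i) = v) ->
  clockwise (codom e) -> (forall x, ~~ odd #|[set i | e i == x]|) ->
  exists c : bool, forall k : 'I_n, odd k = c -> e k = e (ordS k).
Proof.
move=> src_e cw_e even_e.
case: (pickP (fun k => e k != e (ordS k))) => [k ne_k|no_break]; last first.
  by exists true => k _; apply/eqP/negbFE/no_break.
have n_gt0 : 0 < n by exact: leq_ltn_trans (ltn_ord k).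
have break_e : exists i, e i != e (ordS i) by exists k.
exists (odd #|[set i : 'I_n | height e i == 0]|) => l.
apply: contra_eq => ne_l.
by rewrite -(odd_break src_e cw_e break_e (k0 := Ordinal n_gt0) _ even_e ne_l) //=; case: (odd l).
Qed.

End Clockwise.

(** * Flows on a plane map are boundaries *)

Section Homology.
Import GRing.Theory.
Local Open Scope ring_scope.
Variable G : plane_graph.
Implicit Types (a b x y : dart G) (v : vertex G).

Definition edge_rep : pred (dart G) :=
  [pred a | (enum_rank a < enum_rank (opp a))%N].
Local Notation E := {a | edge_rep a}.
Local Notation fc := (froot (@face G)).
Local Notation Fa := {a | froots (@face G) a}.

Lemma face_inj : injective (@face G).
Proof. by move=> a b /cw_inj /(can_inj (@oppK G)). Qed.

Lemma edge_rep_opp a : edge_rep (opp a) = ~~ edge_rep a.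
Proof.
rewrite /edge_rep /= oppK -leqNgt [RHS]leq_eqVlt; case: eqP => // h.
by have := opp_neq a; rewrite (enum_rank_inj (ord_inj h)) eqxx.
Qed.

Lemma big_darts (R : Type) (idx : R) (op : Monoid.com_law idx) (h : dart G -> R) :
  \big[op/idx]_a h a = \big[op/idx]_(a | edge_rep a) op (h a) (h (opp a)).
Proof.
rewrite big_split /= (bigID edge_rep) /=; congr (op _ _).
rewrite [LHS](reindex_inj (can_inj (@oppK G))) /=.
by apply: eq_bigl => a; rewrite edge_rep_opp negbK.
Qed.

Lemma card_dart : #|dart G| = #|{: E}|.*2.
Proof.
rewrite card_sig -sum1_card big_darts -mul2n -sum1_card big_distrr /=.
by apply: eq_bigl => a.
Qed.

Lemma connected_const (T : Type) (h : vertex G -> T) :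
  (forall a, h (src a) = h (tgt a)) -> forall v w, h v = h w.
Proof.
move=> hC v w; have /connectP[q] := connected v w.
elim: q v => /= [v _ -> //|z q IHq v /andP[/exists_inP[a _ /andP[/eqP sa /eqP ta]]]].
by move=> pq lq; rewrite -(IHq z) // -sa -ta.
Qed.

(** Connectedness of the dual graph: [cw] is [face] after [opp], so [s] depends only on the source
    of a dart, and the graph is connected. *)
Lemma face_const_dart (T : eqType) (s : dart G -> T) :
  (forall a, s (face a) = s a) -> (forall a, s (opp a) = s a) ->
  forall a b, s a = s b.
Proof.
move=> sF sO; have sC a : s (cw a) = s a by rewrite -{1}[a]oppK -/(face _) sF sO.
have sV a b : src a = src b -> s a = s b.
  move/eqP; rewrite src_cw; apply: fconnect_invariant => c /=.
  by rewrite sC eqxx.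
have exd v : exists a, src a == v by have [a <-] := src_surj v; exists a.
pose h v := s (xchoose (exd v)).
have hs a : h (src a) = s a by apply: sV; rewrite (eqP (xchooseP (exd _))).
move=> a b; rewrite -!hs; apply: connected_const => c.
by rewrite hs -(sO c) /tgt hs.
Qed.

Definition vertex_sign v a : rat := (src a == v)%:R - (tgt a == v)%:R.
Definition face_sign (f : Fa) a : rat :=
  (fc a == val f)%:R - (fc (opp a) == val f)%:R.

Definition incidence : 'M[rat]_(#|vertex G|, #|{: E}|) :=
  \matrix_(i, j) vertex_sign (enum_val i) (val (enum_val j)).
Definition contours : 'M[rat]_(#|{: Fa}|, #|{: E}|) :=
  \matrix_(i, j) face_sign (enum_val i) (val (enum_val j)).

Lemma sum_enum_val (T : finType) (h : T -> rat) :
  \sum_(i < #|T|) h (enum_val i) = \sum_x h x.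
Proof.
rewrite [RHS](reindex (@enum_val T T)) //=.
exact/onW_bij/enum_val_bij.
Qed.

Lemma sum_edges (h : dart G -> rat) :
  \sum_(j < #|{: E}|) h (val (enum_val j)) = \sum_(a | edge_rep a) h a.
Proof.
rewrite (sum_enum_val (fun e : E => h (val e))).
exact/esym/(big_sub edge_rep).
Qed.

Lemma sum_indicator (T : finType) (h : T -> rat) (x : T) :
  \sum_y h y * (x == y)%:R = h x.
Proof.
rewrite (bigD1 x) //= eqxx mulr1 big1 ?addr0 // => y.
by rewrite eq_sym => /negbTE->; rewrite mulr0.
Qed.

Lemma divergenceE (g : dart G -> rat) v : (forall a, g (opp a) = - g a) ->
  \sum_(a | edge_rep a) g a * vertex_sign v a = \sum_(a | src a == v) g a.
Proof.
move=> gN; rewrite [RHS]big_mkcond big_darts /=; apply: eq_bigr => a _.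
rewrite gN /vertex_sign mulrBr /tgt.
by do 2 case: eqP; rewrite /= ?mulr1 ?mulr0 ?oppr0 ?subr0 ?sub0r ?addr0 ?add0r.
Qed.

(** The boundary of a boundary vanishes. Since [cw a] and [opp a] lie on the same face, shifting one
    of the two sums around the vertex by [cw] cancels the other. *)
Lemma contours_incidence : contours *m incidence^T = 0.
Proof.
apply/matrixP=> i k; rewrite !mxE.
under eq_bigr do rewrite !mxE.
set f := enum_val i; set v := enum_val k.
rewrite (sum_edges (fun a => face_sign f a * vertex_sign v a)).
rewrite divergenceE; last by move=> a; rewrite /face_sign oppK opprB.
rewrite sumrB; apply/eqP; rewrite subr_eq0; apply/eqP.
rewrite [LHS](reindex_inj (@cw_inj G)) /=; apply: eq_big => a.
  by rewrite src_cw1.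
move=> _; rewrite -{1}[a]oppK -/(face (opp a)).
congr ((_ == _)%:R); apply/esym/eqP.
by rewrite root_connect ?fconnect1 //; apply: fconnect_sym face_inj.
Qed.

(** The left kernel lies in the line of constant vectors. Applied to vertices and to faces, this
    gives ranks at least #V - 1 and #F - 1, whose sum is #E by Euler's relation; hence the contours
    fill the kernel of the transposed incidence matrix. *)
Lemma kermx_corank (m n : nat) (A : 'M[rat]_(m, n)) :
  (forall r : 'rV_m, r *m A = 0 -> forall i j, r 0 i = r 0 j) ->
  (m - 1 <= \rank A)%N.
Proof.
move=> kerA; suff : (\rank (kermx A) <= 1)%N.
  by rewrite mxrank_ker; have := rank_leq_row A; lia.
apply: (leq_trans (mxrankS (_ : _ <= (const_mx 1 : 'rV_m))%MS)).
  apply/row_subP => i; apply/sub_rVP.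
  have /kerA rC : row i (kermx A) *m A = 0.
    by rewrite -row_mul mulmx_ker row0.
  exists (row i (kermx A) 0 i); apply/rowP => j.
  by rewrite (rC j i) !mxE mulr1.
exact: rank_leq_row.
Qed.

Lemma rank_incidence : (#|vertex G| - 1 <= \rank incidence)%N.
Proof.
apply: kermx_corank => r /rowP r0 i j.
pose h v := r 0 (enum_rank v).
have hE a : edge_rep a -> h (src a) = h (tgt a).
  move=> Ea; have := r0 (enum_rank (exist _ a Ea : E)); rewrite !mxE.
  under eq_bigr do rewrite mxE enum_rankK /= -[X in r 0 X]enum_valK.
  rewrite (sum_enum_val (fun v => h v * vertex_sign v a)).
  under eq_bigr do rewrite /vertex_sign mulrBr.
  by rewrite sumrB !sum_indicator => /eqP; rewrite subr_eq0 => /eqP.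
rewrite -[i]enum_valK -[j]enum_valK -!/(h _); apply: connected_const => a.
case: (boolP (edge_rep a)) => [/hE //|]; rewrite -edge_rep_opp => /hE.
by rewrite /tgt oppK.
Qed.

Lemma rank_contours : (#|{: Fa}| - 1 <= \rank contours)%N.
Proof.
apply: kermx_corank => r /rowP r0 i j.
have symF := fconnect_sym face_inj.
pose rep a : Fa := exist _ (fc a) (roots_root symF a).
have repE a f : (fc a == val f) = (rep a == f) by [].
pose h f := r 0 (enum_rank f); pose s a := h (rep a).
have hE a : edge_rep a -> s a = s (opp a).
  move=> Ea; have := r0 (enum_rank (exist _ a Ea : E)); rewrite !mxE.
  under eq_bigr do rewrite mxE enum_rankK /= -[X in r 0 X]enum_valK.
  rewrite (sum_enum_val (fun f => h f * face_sign f a)).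
  under eq_bigr => f _ do rewrite /face_sign mulrBr !repE.
  by rewrite sumrB !sum_indicator => /eqP; rewrite subr_eq0 => /eqP.
have sval f : h f = s (val f).
  by rewrite /s; congr h; apply/val_inj/esym/eqP; case: f.
rewrite -[i]enum_valK -[j]enum_valK -!/(h _) !sval.
apply: face_const_dart => a.
  rewrite /s; congr h; apply: val_inj => /=; apply/esym/eqP.
  by rewrite root_connect ?fconnect1.
case: (boolP (edge_rep a)) => [/hE //|]; rewrite -edge_rep_opp => /hE.
by rewrite oppK.
Qed.

(* By Euler's relation, the contours of the faces span the space of all flows. *)
Theorem flow_is_boundary (phi : dart G -> rat) :
  (forall a, phi (opp a) = - phi a) ->
  (forall v, \sum_(a | src a == v) phi a = 0) ->
  exists2 s : dart G -> rat, (forall a, s (face a) = s a)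
    & forall a, s a - s (opp a) = phi a.
Proof.
move=> phiN phi0; have symF := fconnect_sym face_inj.
have sub_ker : (contours <= kermx incidence^T)%MS.
  by apply/sub_kermxP/contours_incidence.
have le_ker : (kermx incidence^T <= contours)%MS.
  rewrite -(mxrank_leqif_sup sub_ker) eqn_leq mxrankS //= mxrank_ker mxrank_tr.
  have := rank_incidence; have := rank_contours; have := planar G.
  rewrite /n_comp_mem (_ : #|predI _ _| = #|{: Fa}|); last first.
    by rewrite card_sig; apply: eq_card => a; rewrite !inE andbT.
  rewrite card_dart doubleK; move: #|vertex G| #|{: Fa}| #|{: E}| (\rank _) (\rank _).
  by clear=> *; lia.
pose w : 'rV[rat]_#|{: E}| := \row_j phi (val (enum_val j)).
have /submxP[D /rowP wD] : (w <= contours)%MS.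
  apply: submx_trans le_ker; apply/sub_kermxP/rowP => k; rewrite !mxE.
  under eq_bigr do rewrite !mxE.
  rewrite (sum_edges (fun a => phi a * vertex_sign (enum_val k) a)).
  by rewrite divergenceE // phi0.
pose rep a : Fa := exist _ (fc a) (roots_root symF a).
have repE a f : (fc a == val f) = (rep a == f) by [].
pose h f := D 0 (enum_rank f).
have hE a : edge_rep a -> h (rep a) - h (rep (opp a)) = phi a.
  move=> Ea; have := wD (enum_rank (exist _ a Ea : E)); rewrite !mxE enum_rankK.
  move=> ->; under eq_bigr do rewrite mxE enum_rankK /= -[X in D 0 X]enum_valK.
  rewrite (sum_enum_val (fun f => h f * face_sign f a)).
  under eq_bigr => f _ do rewrite /face_sign mulrBr !repE.
  by rewrite sumrB !sum_indicator.
exists (fun a => h (rep a)) => a.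
  congr h; apply: val_inj => /=; apply/esym/eqP.
  by rewrite root_connect ?fconnect1.
case: (boolP (edge_rep a)) => [/hE //|]; rewrite -edge_rep_opp => /hE.
by rewrite oppK phiN => h_opp; rewrite -opprB h_opp opprK.
Qed.

End Homology.

(** * External vertices and forests *)

Lemma split_nonuniq (S : eqType) (T : eqType) (f : S -> T) (c : seq S) :
  ~~ uniq (map f c) -> exists c1 x p y q,
    c = c1 ++ (x :: p) ++ (y :: q) /\ f x = f y.
Proof.
elim: c => //= x c IHc; rewrite negb_and negbK => /orP[/mapP[y yc fxy]|/IHc].
  by case/splitPr: c / yc {IHc} => p q; exists [::], x, p, y, q.
by move=> [c1 [z [p [y [q [-> fzy]]]]]]; exists (x :: c1), z, p, y, q.
Qed.

(** * Face contours visit no vertex twice *)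

Section Contour.
Variables (G : plane_graph) (d : nat).
Hypothesis angG : angulation d G.
Hypothesis girthG : has_girth G d.
Implicit Types (a b x y : dart G) (v : vertex G) (c p q : seq (dart G)).

Local Notation follows := (fun a b : dart G => tgt a == src b).

Lemma split_closed_walk c : cycle follows c -> ~~ uniq (map (@src G) c) ->
  exists x p y q, [/\ perm_eq c ((x :: p) ++ (y :: q)),
    cycle follows (x :: p) & cycle follows (y :: q)].
Proof.
move=> cyc_c /split_nonuniq [c1 [x [p [y [q [def_c exy]]]]]].
exists x, p, y, (q ++ c1).
have rot_c : rot (size c1) c = (x :: p) ++ (y :: q ++ c1).
  by rewrite def_c rot_size_cat -catA.
split; first by rewrite -rot_c perm_sym perm_rot.
  move: cyc_c; rewrite -(rot_cycle (size c1)) rot_c /=.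
  by rewrite rcons_cat cat_path /= !rcons_path exy => /and3P[-> ->].
move: cyc_c; rewrite -(rot_cycle (size c1)) rot_c /=.
by rewrite rcons_cat cat_path /= !rcons_path exy => /and3P[_ _ ->].
Qed.

(** Below the girth a closed walk cannot be a simple cycle. It either revisits a vertex, and splits
    into two shorter closed walks, or contains an edge in both directions. In the latter case,
    visiting each vertex once, it is empty or goes back and forth along that edge. *)
Lemma closed_walk_balanced c : cycle follows c -> size c < d ->
  forall a, count_mem a c = count_mem (opp a) c.
Proof.
have [m] := ubnP (size c); elim: m c => // m IHm c le_m cyc_c lt_c a.
case: (boolP (uniq (map (@src G) c))) => [uniq_c|nuniq_c]; last first.
  have [x [p [y [q [perm_c cyc1 cyc2]]]]] := split_closed_walk cyc_c nuniq_c.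
  have := perm_size perm_c; rewrite size_cat /= => sz_c.
  have [lt1 lt2] : size (x :: p) < d /\ size (y :: q) < d.
    by move: sz_c lt_c => /=; clear; lia.
  have [lt1m lt2m] : size (x :: p) < m /\ size (y :: q) < m.
    by move: sz_c le_m => /=; clear; lia.
  move/permP: perm_c => perm_c; rewrite !perm_c !count_cat.
  by rewrite (IHm _ lt1m cyc1 lt1) (IHm _ lt2m cyc2 lt2).
case: (altP (c =P [::])) => [-> //|nil_c].
case: (boolP (all (fun a => opp a \notin c) c)) => [opp_c|].
  have := girthG.2 c; rewrite /simple_cycle nil_c cyc_c uniq_c opp_c => /(_ isT).
  by rewrite leqNgt lt_c.
case/allPn => x xc; rewrite negbK => oxc.
have [i p rot_c] := rot_to xc.
have mem_c z : (z \in x :: p) = (z \in c) by rewrite -rot_c mem_rot.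
have perm_c : perm_eq c (x :: p) by rewrite -rot_c perm_sym perm_rot.
move: (cyc_c) (uniq_c) (oxc); rewrite -(rot_cycle i) rot_c -mem_c.
rewrite (perm_uniq (perm_map _ perm_c)).
case: p rot_c mem_c perm_c => [|y q] rot_c mem_c perm_c.
  by move=> _ _; rewrite inE (negbTE (opp_neq x)).
case/andP=> /= /eqP exy cyc /and3P[nx ny _].
rewrite !inE (negbTE (opp_neq x)) /= => oxp.
have oxy : opp x = y.
  case/orP: oxp => [/eqP //|oxq]; case/negP: ny; rewrite -exy.
  exact: (map_f (@src G) oxq).
case: q {rot_c mem_c oxp ny} cyc nx perm_c => [_ _|z r] /=.
  move/permP=> perm_c; rewrite !perm_c /= -oxy (inj_eq (can_inj (@oppK G))).
  by rewrite !addn0 addnC; congr (nat_of_bool _ + _); rewrite -{1}[a]oppK (inj_eq (can_inj (@oppK G))).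
by case/andP=> /eqP eyz _; rewrite !inE -eyz -oxy /tgt oppK eqxx orbT.
Qed.

Lemma face_follows a b : face a = b -> tgt a = src b.
Proof. by move=> <-; rewrite /face src_cw1. Qed.

(** A repeated vertex would split the contour into two balanced walks, making it stable under [opp].
    It would then contain every dart by connectedness, but a shortest cycle and its reverse already
    provide [2d] distinct darts, more than the [d] darts of a face. *)
Lemma face_contour_uniq a : uniq (map (@src G) (orbit (@face G) a)).
Proof.
set c := orbit _ a; apply/negPn/negP=> nuniq_c.
have cyc_c : cycle follows c.
  apply: sub_cycle (cycle_orbit (@face_inj G) a) => x y /eqP xy.
  by apply/eqP/face_follows.
have sz_c : size c = d by rewrite size_orbit angG.
have [x [p [y [q [perm_c cyc1 cyc2]]]]] := split_closed_walk cyc_c nuniq_c.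
have := perm_size perm_c; rewrite size_cat /= sz_c => sz_d.
have opp_c z : (opp z \in c) = (z \in c).
  move/permP: perm_c => perm_c; rewrite -!has_pred1 !has_count !perm_c !count_cat.
  have [lt1 lt2] : size (x :: p) < d /\ size (y :: q) < d.
    by move: sz_d => /=; clear; lia.
  by rewrite -(closed_walk_balanced cyc1 lt1) -(closed_walk_balanced cyc2 lt2).
have all_c z : z \in c.
  suff -> : (z \in c) = (a \in c) by exact: in_orbit.
  apply: (face_const_dart (s := mem c)) => b.
    by rewrite /= -!fconnect_orbit -same_fconnect1_r //; exact: face_inj.
  exact: opp_c.
have [cyc /and4P[_ _ uniq_cyc opp_cyc] sz_cyc] := girthG.1.
have uniq2 : uniq (cyc ++ map (@opp G) cyc).
  rewrite cat_uniq (map_inj_uniq (can_inj (@oppK G))) (map_uniq uniq_cyc) andbT /=.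
  by apply/hasPn => _ /mapP[z /(allP opp_cyc) ? ->].
have := uniq_leq_size uniq2 (s2 := c) (fun z _ => all_c z).
rewrite size_cat size_map sz_cyc sz_c; lia.
Qed.

End Contour.

Section ExternalVertices.
Variables (G : plane_graph) (d : nat) (u : nat -> vertex G).
Hypothesis angG : angulation d G.
Hypothesis girthG : has_girth G d.
Hypothesis clockwise_u : external_clockwise u.

Lemma external_inj (i j : 'I_d) : u i = u j -> i = j.
Proof.
have [a _ def_u] := clockwise_u; rewrite !def_u => eq_ij.
have lt_i (k : 'I_d) : k < order (@face G) a by rewrite angG.
have := nth_uniq (src a) (s := map (@src G) (orbit (@face G) a)) (i := i) (j := j).
rewrite size_map size_orbit !lt_i (face_contour_uniq angG girthG) => /(_ isT isT isT).
rewrite !(nth_map a) ?size_orbit ?lt_i // !nth_traject ?lt_i // eq_ij eqxx.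
by move/esym/eqP/ord_inj.
Qed.

Lemma external_contourP j : exists2 b, b \in external_contour G & src b = u j.
Proof.
have [a a_ext def_u] := clockwise_u.
exists (iter j (@face G) a); last by rewrite def_u.
move: a_ext; rewrite !inE => /connect_trans; apply; exact: fconnect_iter.
Qed.

Lemma external_not_internal j : u j \notin internal_vertices G.
Proof.
rewrite inE negbK; have [b b_ext <-] := external_contourP j.
exact: imset_f.
Qed.

Lemma not_internalP v : v \notin internal_vertices G -> exists j : 'I_d, v = u j.
Proof.
rewrite inE negbK => /imsetP[b b_ext ->].
have [a a_ext def_u] := clockwise_u.
have ab : fconnect (@face G) a b.
  move: a_ext b_ext; rewrite !inE => a_ext.
  by apply: connect_trans; rewrite fconnect_sym //; exact: face_inj.
have lt_d : findex (@face G) a b < d by rewrite -(angG a) findex_max.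
by exists (Ordinal lt_d); rewrite def_u /= iter_findex.
Qed.

Lemma external_color black : proper_coloring black -> black (u 1) ->
  forall j, black (u j) = odd j.
Proof.
move=> col u1; have [a _ def_u] := clockwise_u.
have stepu j : black (u j.+1) = ~~ black (u j).
  have := col (iter j (@face G) a).
  by rewrite (face_follows (erefl (face _))) !def_u /=; do 2 case: (black _).
by elim=> [|j IHj]; rewrite ?stepu ?IHj //; move: u1; rewrite stepu; case: (black _).
Qed.

Lemma internal_neq_external v j : v \in internal_vertices G -> v != u j.
Proof. by apply: contraTneq => ->; apply: external_not_internal. Qed.

End ExternalVertices.

(** * Forests with one outgoing arc at each internal vertex *)

Section Forests.
Variables (G : plane_graph) (d : nat) (u : nat -> vertex G).
Hypothesis angG : angulation d G.
Hypothesis girthG : has_girth G d.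
Hypothesis clockwise_u : external_clockwise u.
Implicit Types (a b x y : dart G) (v w : vertex G) (A : {set dart G}).

Lemma adjP A v w : reflect (exists2 a, a \in A & src a = v /\ tgt a = w) (adj A v w).
Proof.
apply: (iffP exists_inP) => -[a aA].
  by case/andP=> /eqP sa /eqP ta; exists a.
by case=> sa ta; exists a; rewrite // sa ta !eqxx.
Qed.

Lemma connect_ind A (P : vertex G -> Prop) v w : connect (adj A) v w ->
  P v -> (forall a, a \in A -> P (src a) -> P (tgt a)) -> P w.
Proof.
case/connectP=> q; elim: q v => [v _ -> //|z q IHq v /= /andP[/adjP[a aA [sa ta]] pq] lq].
by move=> Pv PA; apply: (IHq z) => //; rewrite -ta; apply: (PA a); rewrite ?sa.
Qed.

Lemma connect_ind_rev A (P : vertex G -> Prop) v w : connect (adj A) v w ->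
  P w -> (forall a, a \in A -> P (tgt a) -> P (src a)) -> P v.
Proof.
case/connectP=> q; elim: q v => [v _ -> //|z q IHq v /= /andP[/adjP[a aA [sa ta]] pq] lq].
by move=> Pw PA; rewrite -sa; apply: (PA a) => //; rewrite ta; apply: IHq.
Qed.

Lemma connect_dart A a : a \in A -> connect (adj A) (src a) (tgt a).
Proof. by move=> aA; apply/connect1/adjP; exists a. Qed.

Lemma adj_path_darts A v q : path (adj A) v q -> exists c : seq (dart G),
  [/\ all (mem A) c, map (@src G) c = belast v q & map (@tgt G) c = q].
Proof.
elim: q v => [|z q IHq] v /=; first by exists [::].
case/andP=> /adjP[a aA [sa ta]] /IHq[c [cA sc tc]].
by exists (a :: c); rewrite /= aA cA sa sc ta tc.
Qed.

Lemma directed_simple_cycle A a : (forall b, b \in A -> opp b \notin A) ->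
  a \in A -> connect (adj A) (tgt a) (src a) ->
  exists2 c, simple_cycle c & all (mem A) c.
Proof.
move=> antiA aA /connectP[q0 pq0 lq0].
case/shortenP: pq0 lq0 => q pq uq _ lq.
have [c [cA sc tc]] := adj_path_darts pq.
exists (a :: c); last by rewrite /= aA cA.
apply/and4P; split=> //.
- rewrite (cycle_path a) /=.
  have chain z b r : map (@src G) r = belast z (map (@tgt G) r) -> tgt b = z ->
      path (fun x y => tgt x == src y) b r.
    elim: r z b => //= y r IHr z b [sy sr] tb.
    by rewrite tb sy eqxx; apply: (IHr (tgt y)).
  rewrite -{1}tc in sc.
  rewrite (chain (tgt a)) // andbT lq.
  rewrite -tc; case: (lastP c) => [|c' y]; first by rewrite /=.
  by rewrite map_rcons !last_rcons.
- rewrite /= sc; move: uq; rewrite lastI rcons_uniq -lq => /andP[-> ?]; exact.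
apply/allP=> b; rewrite -[b \in _]/(b \in mem (a :: c)).
move=> bc; have bA : b \in A.
  by move: bc; rewrite inE => /predU1P[->//|/(allP cA)].
apply: contra (antiA b bA); rewrite inE => /predU1P[->//|/(allP cA)//].
Qed.

(** An arc leaving an external vertex leaves a root, since the source is spanned. Its target lies in
    the tree of that same root and has a directed path to it, which closes a directed cycle. *)
Lemma forest_src_internal (k : 'I_d) A a : spanning_forest u k A ->
  a \in A -> src a \in internal_vertices G.
Proof.
case=> -[antiA acyc] span_A root_A aA; apply/negPn/negP.
move/(not_internalP angG clockwise_u)=> [j src_a].
have /andP[] := span_A a aA; rewrite src_a => /andP[njk njS] span_t.
have [l [_ con_l uniq_l]] := root_A _ span_t.
have jl : j = l.
  apply: uniq_l.
    by apply/andP; split; [move: njk | move: njS]; apply: contraNneq => ->.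
  rewrite -src_a -[src a](congr1 (@src G) (oppK a)).
  by apply: connect_dart; rewrite inE oppK aA orbT.
have [|c sc cA] := directed_simple_cycle antiA aA; first by rewrite src_a jl.
have /negP[] := acyc c sc; apply/allP=> b bc.
by rewrite /= inE; apply/orP; left; apply: (allP cA).
Qed.

Definition arc A v : dart G := odflt (outer G) [pick a | (a \in A) && (src a == v)].

Definition functional A :=
  forall v, v \in internal_vertices G -> out_arcs A v = [set arc A v].

Lemma arc_out A v x : out_arcs A v = [set x] -> arc A v = x.
Proof.
move=> /setP out_A; rewrite /arc; case: pickP => [a aP|no_a] /=.
  by have := out_A a; rewrite !inE aP => /esym/eqP.
by have := no_a x; have := out_A x; rewrite !inE eqxx => ->.
Qed.

Lemma functional_arc A v : functional A -> v \in internal_vertices G ->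
  arc A v \in A /\ src (arc A v) = v.
Proof.
move=> fA /fA /setP/(_ (arc A v)); rewrite !inE eqxx.
by case/andP=> ? /eqP.
Qed.

Lemma arc_src A a : functional A -> a \in A -> src a \in internal_vertices G ->
  arc A (src a) = a.
Proof.
move=> fA aA /fA /setP/(_ a); rewrite !inE aA eqxx /=.
by move=> /esym/eqP.
Qed.

(** With one outgoing arc per internal vertex and none elsewhere, reaching an external vertex from
    everywhere already gives the acyclicity and the uniqueness of the roots, even for unoriented
    cycles and paths. *)
Lemma functional_forest (k : 'I_d) A : functional A ->
  (forall a, a \in A -> src a \in internal_vertices G) ->
  (forall a, a \in A -> opp a \notin A) ->
  (forall a, a \in A -> (tgt a != u k) && (tgt a != u (ordS k))) ->
  (forall v, exists j : 'I_d, connect (adj A) v (u j)) ->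
  spanning_forest u k A.
Proof.
move=> fA intA antiA avoidA rootA.
have injA a b : a \in A -> b \in A -> src a = src b -> a = b.
  by move=> aA bA sab; rewrite -(arc_src fA aA) ?intA // sab (arc_src fA bA) ?intA.
split.
- split=> // c /and4P[nil_c cyc uniq_c opp_c]; apply/negP=> /allP cA.
  (* [r] orients each edge of the cycle along [A]. The sources obtained are distinct, hence exhaust
     the vertices of the cycle, so the arcs of [A] never leave it: the external vertex reached from
     it would be the source of an arc. *)
  pose r x := if x \in A then x else opp x.
  have rA x : x \in c -> r x \in A.
    by move/cA; rewrite /= inE /r; case: ifP => // ->.
  have tgt_c x : x \in c -> tgt x \in map (@src G) c.
    move=> xc; have := next_cycle cyc xc => /eqP ->.
    by rewrite map_f // mem_next.
  have src_r x : x \in c -> src (r x) \in map (@src G) c.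
    by move=> xc; rewrite /r; case: ifP => _; [rewrite map_f | apply: tgt_c].
  have tgt_r x : x \in c -> tgt (r x) \in map (@src G) c.
    move=> xc; rewrite /r; case: ifP => _; first exact: tgt_c.
    by rewrite /tgt oppK map_f.
  have uniq_r : uniq (map (fun x => src (r x)) c).
    rewrite map_inj_in_uniq ?(map_uniq uniq_c) // => x y xc yc.
    move/(injA _ _ (rA _ xc) (rA _ yc)); rewrite /r.
    case: ifP => _; case: ifP => _;
      [by [] | move=> def_x | move=> def_y | by move/(can_inj (@oppK G))].
      by have := allP opp_c _ yc; rewrite -def_x xc.
    by have := allP opp_c _ xc; rewrite def_y yc.
  have sub_r : {subset map (fun x => src (r x)) c <= map (@src G) c}.
    by move=> _ /mapP[x xc ->]; apply: src_r.
  have [|_ mem_r] := uniq_min_size uniq_r sub_r; first by rewrite !size_map.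
  have clA a : a \in A -> src a \in map (@src G) c -> tgt a \in map (@src G) c.
    move=> aA; rewrite -mem_r => /mapP[x xc sax].
    by rewrite (injA _ _ aA (rA _ xc) sax) tgt_r.
  have [x xc] : exists x, x \in c.
    by case: (c) nil_c => // x c' _; exists x; rewrite mem_head.
  have [j con_j] := rootA (src x).
  have : u j \in map (@src G) c.
    by apply: (connect_ind (P := fun w => w \in map _ c) con_j); [exact: map_f|].
  rewrite -mem_r => /mapP[y yc def_y].
  by have := internal_neq_external clockwise_u j (intA _ (rA _ yc)); rewrite def_y eqxx.
- move=> a aA; rewrite avoidA // andbT.
  by rewrite !(internal_neq_external clockwise_u) ?intA.
move=> v span_v; have [j con_j] := rootA v; exists j.
have span_j : (u j != u k) && (u j != u (ordS k)).
  by apply: (connect_ind (P := fun w => (w != u k) && (w != u (ordS k))) con_j) => // a aA _; apply: avoidA.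
split=> //.
  by case/andP: span_j => njk njS; apply/andP; split;
    [move: njk | move: njS]; apply: contraNneq => ->.
move=> l _ con_l.
(* Following an arc does not change the root that is reached, because the arc is the only way out of
   its source. This makes the root constant along unoriented paths. *)
have same_root a : a \in A ->
    connect (adj A) (src a) (u j) = connect (adj A) (tgt a) (u j).
  move=> aA; apply/idP/idP => [|con_t]; last exact: connect_trans (connect_dart aA) con_t.
  case/connectP=> -[_ /= uj|z q /= /andP[/adjP[b bA [sb tb]] pq lq]].
    by have := internal_neq_external clockwise_u j (intA a aA); rewrite uj eqxx.
  by rewrite (injA a b aA bA) // tb; apply/connectP; exists q.
have : connect (adj A) (u l) (u j).
  apply: (connect_ind (P := fun w => connect (adj A) w (u j)) con_l) => // a; rewrite inE => /orP[aA|aA].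
    by rewrite same_root.
  by have := same_root _ aA; rewrite /tgt oppK => ->.
case/connectP=> -[_ /= uj|z q /= /andP[/adjP[b bA [sb _]] _ _]].
  exact: (external_inj angG girthG clockwise_u).
by have := internal_neq_external clockwise_u l (intA b bA); rewrite sb eqxx.
Qed.

End Forests.

(** * Even Schnyder decompositions *)

Section DoubleIndices.
Variable p : nat.
Implicit Types (i : 'I_p) (k : 'I_p.*2).

Lemma odd_ordS k : odd (ordS k) = ~~ odd k.
Proof.
rewrite /= [in RHS](_ : ~~ odd k = odd k.+1) // [in RHS](divn_eq k.+1 p.*2).
by rewrite oddD oddM odd_double andbF.
Qed.

Lemma ordS2_dbl i : ordS (ordS (dbl i)) = dbl (ordS i).
Proof.
apply: val_inj; rewrite /= -[in LHS]addn1 modnDml addn1 -doubleS.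
by rewrite -!muln2 -muln_modl.
Qed.

Lemma ord_pred_dbl i : ord_pred (dbl i) = ordS (dbl (ord_pred i)).
Proof. by rewrite -{1}[i]ord_predK -ordS2_dbl ordSK. Qed.

Lemma half_subproof k : k./2 < p.
Proof. by have := ltn_ord k; lia. Qed.

Definition half_ord k : 'I_p := Ordinal (half_subproof k).

Lemma half_dbl i : half_ord (dbl i) = i.
Proof. by apply: val_inj; rewrite /= doubleK. Qed.

Lemma val_ordS_dbl i : ordS (dbl i) = i.*2.+1 :> nat.
Proof. by rewrite /= modn_small //; have := ltn_ord i; lia. Qed.

Lemma half_ordS_dbl i : half_ord (ordS (dbl i)) = i.
Proof. by apply: val_inj; rewrite -[LHS]/((ordS (dbl i))./2) val_ordS_dbl /=; lia. Qed.

Lemma dbl_half k : ~~ odd k -> dbl (half_ord k) = k.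
Proof. by move=> ek; apply: val_inj => /=; lia. Qed.

Lemma ordS_dbl_half k : odd k -> ordS (dbl (half_ord k)) = k.
Proof. by move=> ok; apply: ord_inj; rewrite val_ordS_dbl /=; lia. Qed.

Lemma dbl_cases (P : 'I_p.*2 -> Prop) :
  (forall i, P (dbl i)) -> (forall i, P (ordS (dbl i))) -> forall k, P k.
Proof.
move=> Pe Po k; case: (boolP (odd k)) => [/ordS_dbl_half <- //|/dbl_half <- //].
Qed.

Lemma sum_dbl (F : 'I_p.*2 -> nat) :
  \sum_k F k = \sum_i (F (dbl i) + F (ordS (dbl i))).
Proof.
rewrite big_split /= (bigID (fun k : 'I_p.*2 => odd k)) /= addnC; congr (_ + _).
  rewrite (reindex_onto (@dbl p) half_ord) /=; last by move=> k /dbl_half.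
  by apply: eq_bigl => i; rewrite odd_double half_dbl eqxx.
rewrite (reindex_onto (fun i => ordS (dbl i)) half_ord); last by move=> k /ordS_dbl_half.
by apply: eq_bigl => i; rewrite half_ordS_dbl eqxx andbT odd_ordS /= odd_double.
Qed.

Lemma card_dbl (P : pred 'I_p.*2) :
  #|[set k | P k]| = #|[set i | P (dbl i)]| + #|[set i | P (ordS (dbl i))]|.
Proof.
rewrite -!sum1_card [LHS]big_mkcond sum_dbl big_split /=; congr (_ + _).
  by rewrite [RHS]big_mkcond; apply: eq_bigr => i _; rewrite !inE.
by rewrite [RHS]big_mkcond; apply: eq_bigr => i _; rewrite !inE.
Qed.

End DoubleIndices.

Section EvenDecompositions.
Variables (p : nat) (G : plane_graph) (u : nat -> vertex G) (black : pred (vertex G)).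
Hypothesis p_ge2 : 2 <= p.
Hypothesis angG : angulation p.*2 G.
Hypothesis clockwise_u : external_clockwise u.
Hypothesis coloring : proper_coloring black.
Hypothesis black_u1 : black (u 1).
Implicit Types (a b x y : dart G) (v w : vertex G).

Let black_u := external_color clockwise_u coloring black_u1.

Lemma black_tgt a : black (tgt a) = ~~ black (src a).
Proof. by have := coloring a; do 2 case: (black _). Qed.

Lemma mem_out_arcs (A : {set dart G}) v x a :
  out_arcs A v = [set x] -> src a = v -> (a \in A) = (a == x).
Proof. by move=> /setP/(_ a); rewrite !inE => <- ->; rewrite eqxx andbT. Qed.

Lemma out_arcs_mem (A : {set dart G}) v x :
  out_arcs A v = [set x] -> x \in A /\ src x = v.
Proof. by move=> /setP/(_ x); rewrite !inE eqxx => /andP[? /eqP]. Qed.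

(** * The pairing of colors in an even decomposition *)

Section EvenSchnyder.
Variable F : {ffun 'I_p.*2 -> {set dart G}}.
Hypothesis schnyderF : schnyder_decomposition u F.
Hypothesis evenF : even_decomposition F.

Lemma schnyder_src_internal k a : a \in F k -> src a \in internal_vertices G.
Proof.
case: schnyderF => _ _ forF _.
exact: (forest_src_internal angG clockwise_u (forF k)).
Qed.

Lemma schnyder_opp k a : a \in F k -> opp a \notin F k.
Proof. by case: schnyderF => _ _ /(_ k) [[anti _] _ _] _; apply: anti. Qed.

Lemma card_colors a : a \in internal_darts G ->
  #|[set k | a \in F k]| + #|[set k | opp a \in F k]| = p.*2 - 2.
Proof.
case: schnyderF => _ /(_ a) cardF _ _ /cardF <-.
rewrite -cardsUI (_ : _ :&: _ = set0) ?cards0 ?addn0.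
  by apply: eq_card => k; rewrite !inE.
apply/setP=> k; rewrite !inE; apply/negP=> /andP[/schnyder_opp aF].
by rewrite (negbTE aF).
Qed.

(** Exactly two colors are absent from an internal edge, counting both of its arcs, so two absent
    ones leave room for no third. *)
Lemma colors_of_edge a j1 j2 k : a \in internal_darts G -> j1 != j2 ->
  a \notin F j1 -> opp a \notin F j1 -> a \notin F j2 -> opp a \notin F j2 ->
  [|| a \in F k, opp a \in F k, k == j1 | k == j2].
Proof.
move=> int_a nj a1 o1 a2 o2; apply: contraT; rewrite !negb_or.
case/and4P=> ak ok k1 k2; pose X := [set j1; j2; k].
have cX : #|X| = 3 by rewrite /X setUC cardsU1 cards2 nj !inE negb_or k1 k2.
have := card_colors int_a; rewrite -cardsUI; set U := _ :|: _ => cU.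
have U0 : #|[set k | a \in F k] :&: [set k | opp a \in F k]| = 0.
  apply: eq_card0 => l; rewrite !inE; apply/negP=> /andP[/schnyder_opp aF].
  by rewrite (negbTE aF).
have UX : #|U :&: X| = 0.
  apply: eq_card0 => l; rewrite !inE; apply/negP=> /andP[h1 h2].
  by move: h2 h1 => /orP[/orP[]|] /eqP ->; rewrite ?(negbTE a1, negbTE o1,
     negbTE a2, negbTE o2, negbTE ak, negbTE ok).
have := max_card (mem (U :|: X)); rewrite card_ord.
by rewrite -[#|mem _|]/(#|U :|: X|) => leU; have := cardsUI U X; move: cU leU; rewrite U0 UX cX; clear -p_ge2; lia.
Qed.

(** If all outgoing arcs at [v] coincided, one edge would carry all [p.*2] colors instead of
    [p.*2 - 2]. *)
Lemma schnyder_break v (e : 'I_p.*2 -> dart G) :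
  (forall i, out_arcs (F i) v = [set e i]) -> exists i, e i != e (ordS i).
Proof.
move=> out_e; case: (pickP (fun i => e i != e (ordS i))) => [i|no_break]; first by exists i.
have lt0 : 0 < p.*2 by lia.
pose k0 := Ordinal lt0.
have constF i : e k0 \in F i.
  apply: (ordS_closed_full (P := fun i => e k0 \in F i) (k := k0)).
    exact: (out_arcs_mem (out_e k0)).1.
  move=> {}i; have [ei si] := out_arcs_mem (out_e k0).
  rewrite !(mem_out_arcs (out_e _) si).
  by have /negbFE/eqP -> := no_break i.
have int_a : e k0 \in internal_darts G.
  by case: schnyderF => /(_ k0)/subsetP subF _ _ _; apply: subF.
have := card_colors int_a; rewrite (_ : [set k | _] = setT); last first.
  by apply/setP=> k; rewrite !inE constF.
by rewrite cardsT card_ord; clear -p_ge2; lia.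
Qed.

Lemma schnyder_pairing v (e : 'I_p.*2 -> dart G) :
  (forall i, out_arcs (F i) v = [set e i]) -> clockwise (codom e) ->
  exists c : bool, forall k : 'I_p.*2, odd k = c -> e k = e (ordS k).
Proof.
move=> out_e cw_e; apply: (clockwise_pairing (v := v)) cw_e _.
  by move=> i; apply: (out_arcs_mem (out_e i)).2.
move=> x; case: (pickP (fun i => e i == x)) => [i /eqP ex|no_x]; last first.
  rewrite (_ : [set i | _] = set0) ?cards0 //.
  by apply/setP=> i; rewrite !inE no_x.
have [xF sx] := out_arcs_mem (out_e i); rewrite ex in xF sx.
rewrite (_ : [set i | _] = [set i | x \in F i]); last first.
  by apply/setP=> k; rewrite !inE (mem_out_arcs (out_e k) sx) eq_sym.
apply: evenF; case: schnyderF => /(_ i)/subsetP subF _ _ _; exact: subF.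
Qed.

Definition paired v := forall (k : 'I_p.*2) a,
  odd k = black v -> src a = v -> (a \in F k) = (a \in F (ordS k)).

Lemma ordS_neq (k : 'I_p.*2) : ordS k != k.
Proof. by apply/eqP=> /(congr1 (fun l => odd (nat_of_ord l))); rewrite odd_ordS; case: odd. Qed.

Lemma ordS2_neq (k : 'I_p.*2) : ordS (ordS k) != k.
Proof.
apply/eqP=> /(congr1 val) /=; rewrite -[X in X %% _]addn1 modnDml addn1.
have := ltn_ord k; case: (ltnP k.+2 p.*2) => h lt_k.
  by rewrite modn_small //; lia.
have -> : k.+2 = k.+2 - p.*2 + p.*2 by lia.
by rewrite modnDr modn_small; lia.
Qed.

(** If [src a] had the wrong pairing, it would pair the same parity as [tgt a]. The edge of [a] then
    misses two consecutive colors paired at both ends, and the rule at [tgt a] leaves no position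
    for [opp a]. *)
Lemma paired_step k0 a : a \in F k0 -> paired (tgt a) -> paired (src a).
Proof.
move=> aF pair_w; set v := src a; set w := tgt a in pair_w *.
have [subF _ forF locF] := schnyderF.
have int_v := schnyder_src_internal aF.
have int_a : a \in internal_darts G by apply: (subsetP (subF k0)).
have [e [out_e cw_e _]] := locF v int_v.
have [c pair_e] := schnyder_pairing out_e cw_e.
case: (eqVneq c (black v)) => [def_c k b odd_k src_b|].
  by rewrite !(mem_out_arcs (out_e _) src_b) pair_e // odd_k def_c.
move=> ne_c; exfalso.
have def_c : c = black w.
  by rewrite /w black_tgt -/v; case: (c) (black v) ne_c => [] [].
have mem_e k : (a \in F k) = (a == e k) by apply: (mem_out_arcs (out_e k)).
have [l al] : exists l, a \notin F l.
  case: (pickP (fun l => a \notin F l)) => [l al|all_a]; first by exists l.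
  have := card_colors int_a; rewrite (_ : [set k | _] = setT); last first.
    by apply/setP=> k; rewrite !inE; apply/negbFE/all_a.
  by rewrite cardsT card_ord; clear -p_ge2; lia.
(* The last color [i] of a run of colors of [a] cannot be paired with the next one, which fixes its
   parity; hence [ordS i] is paired with its successor and both are absent from [a]. *)
have [i ai aSi] := ordS_boundary (P := fun k => a \in F k) aF al.
have odd_i : odd i = ~~ black w.
  case: (eqVneq (odd i) c) => [/pair_e eq_e|]; last first.
    by rewrite def_c; case: (odd i) (black w) => [] [].
  by move: ai aSi; rewrite !mem_e eq_e => ->.
have odd_Si : odd (ordS i) = black w by rewrite odd_ordS odd_i negbK.
have aSSi : a \notin F (ordS (ordS i)).
  by rewrite mem_e -(pair_e (ordS i)) ?odd_Si ?def_c // -mem_e.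
(* If [w] is the external vertex [u j], the two colors absent from the edge are [j] and
   [ord_pred j], those of the forests avoiding [u j]. Parity forces [ordS i = j], and then its
   successor would be absent too. *)
case: (boolP (w \in internal_vertices G)) => [int_w|ext_w]; last first.
  have [j def_w] := not_internalP angG clockwise_u ext_w.
  have no_opp k : opp a \notin F k.
    by apply: contra ext_w => /schnyder_src_internal.
  have aj : a \notin F j.
    case: (forF j) => _ span_j _; apply/negP=> /span_j.
    by rewrite -/w def_w eqxx andbF.
  have aPj : a \notin F (ord_pred j).
    case: (forF (ord_pred j)) => _ span_j _; apply/negP=> /span_j.
    by rewrite -/w def_w ord_predK eqxx !andbF.
  have odd_j : odd j = black w by rewrite def_w black_u.
  have njPj : j != ord_pred j by rewrite -{1}[j]ord_predK ordS_neq.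
  have odd_Pj : odd (ord_pred j) = ~~ black w.
    by rewrite -odd_j -[in RHS](ord_predK j) odd_ordS negbK.
  have := colors_of_edge (ordS i) int_a njPj aj (no_opp _) aPj (no_opp _).
  rewrite (negbTE aSi) (negbTE (no_opp _)) /= => /orP[]/eqP def_Si; last first.
    by move: odd_Pj; rewrite -def_Si odd_Si; case: (black w).
  have := colors_of_edge (ordS (ordS i)) int_a njPj aj (no_opp _) aPj (no_opp _).
  rewrite (negbTE aSSi) (negbTE (no_opp _)) /= def_Si (negbTE (ordS_neq j)) /=.
  by move/eqP=> eq_S; have := ordS2_neq (ord_pred j); rewrite ord_predK eq_S eqxx.
have [e' [out_e' cw_e' between_e']] := locF w int_w.
have src_e' k : src (e' k) = w := (out_arcs_mem (out_e' k)).2.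
have src_oa : src (opp a) = w by [].
have mem_e' k : (opp a \in F k) = (opp a == e' k) by apply: (mem_out_arcs (out_e' k)).
have pair_e' (k : 'I_p.*2) : odd k = black w -> e' k = e' (ordS k).
  move=> odd_k; have [ek_in _] := out_arcs_mem (out_e' k).
  by apply/eqP; rewrite -(mem_out_arcs (out_e' _) (src_e' k)) -pair_w // src_e'.
(* An incoming arc of color [i] is strictly after the outgoing arc of color [ordS i], hence on a
   different edge. *)
have oSi : opp a \notin F (ordS i).
  by rewrite mem_e'; have /and4P[] := between_e' _ _ ai erefl.
have oSSi : opp a \notin F (ordS (ordS i)) by rewrite -(pair_w (ordS i)).
have ne_Si : ordS i != ordS (ordS i) by rewrite eq_sym ordS_neq.
have only k : a \notin F k -> opp a \notin F k -> (k == ordS i) || (k == ordS (ordS i)).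
  move=> ak ok; have := colors_of_edge k int_a ne_Si aSi oSi aSSi oSSi.
  by rewrite (negbTE ak) (negbTE ok).
(* At the end [l'] of a run of colors of [opp a], the next color cannot be on [a] either, by the
   other bound of the sector. So [ordS l'] is one of the two absent colors, and neither is
   possible. *)
have no_opp k : opp a \notin F k.
  apply/negP=> ok.
  have [l' ol' oSl'] := ordS_boundary (P := fun k => opp a \in F k) ok oSi.
  have odd_l' : odd l' = ~~ black w.
    case: (eqVneq (odd l') (black w)) => [odd_l'|]; last by case: (odd l') (black w) => [] [].
    by move: ol' oSl'; rewrite -(pair_w l') // => ->.
  have aSl' : a \notin F (ordS l').
    apply/negP=> aSl'; have /and4P[_] := between_e' _ _ aSl' erefl.
    by rewrite ordSK -mem_e' ol'.
  case/orP: (only _ aSl' oSl') => /eqP eq_l'.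
    by have := schnyder_opp ai; rewrite -(ordS_inj eq_l') ol'.
  have := congr1 (fun k : 'I_p.*2 => odd k) eq_l'.
  by rewrite odd_ordS odd_l' (odd_ordS (ordS i)) odd_Si; case: (black w).
have lt0 : 0 < p.*2 by clear -p_ge2; lia.
(* The sector at [w] containing [opp a] is bounded by a break, so [j] has the unpaired parity and
   [e'] agrees on [ord_pred j] and [j], and on [ordS j] and its successor. Color [j] or [ordS j] on
   [a] would thus place [opp a] in the complementary sector. Both would have to be absent, which
   contradicts the parity. *)
have [j lt_j] := sector_of src_e' cw_e' (schnyder_break out_e') (k0 := Ordinal lt0) erefl src_oa.
have ne_j : e' j != e' (ordS j) by apply: contraTneq lt_j => <-; rewrite findex0.
have odd_j : odd j = ~~ black w.
  case: (eqVneq (odd j) (black w)) => [/pair_e' eq_e|]; last by case: (odd j) (black w) => [] [].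
  by rewrite eq_e eqxx in ne_j.
have Sj : e' (ordS (ordS j)) = e' (ordS j).
  by rewrite -pair_e' // odd_ordS odd_j negbK.
have Pj : e' (ord_pred j) = e' j.
  rewrite pair_e' ?ord_predK //.
  by rewrite -[in odd _](ord_predK j) odd_ordS in odd_j; apply: negb_inj.
have absurd : ~ strictly_between (e' (ordS j)) (opp a) (e' j).
  move/findex_gt_of_between; rewrite !src_e' => /(_ ne_j erefl) gt_j.
  by have := ltn_trans gt_j lt_j; rewrite ltnn.
case: (boolP (a \in F j)) => [aj|naj].
  by apply: absurd; rewrite -Pj; apply: between_e'.
case: (boolP (a \in F (ordS j))) => [aj|naSj].
  by apply: absurd; rewrite -Sj -{2}(ordSK j); apply: between_e'.
have only_j := only _ naj (no_opp _); have only_Sj := only _ naSj (no_opp _).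
case/orP: only_j => /eqP def_j; first by move: odd_j; rewrite def_j odd_Si; case: (black w).
case/orP: only_Sj => /eqP def_Sj.
  by have := ordS2_neq (ordS i); rewrite -def_j def_Sj eqxx.
by have := ordS_neq j; rewrite def_Sj -def_j eqxx.
Qed.

(** External vertices are paired vacuously, having no outgoing arc. An internal vertex inherits the
    pairing backwards along its path to a root in the forest of color 0. *)
Lemma all_paired v : paired v.
Proof.
have ext_paired w : w \notin internal_vertices G -> paired w.
  move=> ext_w k a _ def_w.
  have no_a l : a \notin F l.
    by apply: contra ext_w => /schnyder_src_internal; rewrite def_w.
  by rewrite !(negbTE (no_a _)).
case: (boolP (v \in internal_vertices G)) => [int_v|]; last exact: ext_paired.
have lt0 : 0 < p.*2 by lia.
have [_ _ forF _] := schnyderF.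
have [_ _ root] := forF (Ordinal lt0).
have [|j [_ con_j _]] := root v.
  by rewrite !(internal_neq_external clockwise_u).
apply: (connect_ind_rev (P := paired) con_j); last by move=> a; apply: paired_step.
exact/ext_paired/external_not_internal.
Qed.

Lemma odd_color_mem i a :
  (a \in F (ordS (dbl i))) = (a \in F (dbl (if black (src a) then ordS i else i))).
Proof.
case: ifP => black_a; last first.
  by rewrite -(all_paired (k := dbl i) (v := src a)) //= odd_double.
rewrite -ordS2_dbl; apply: (all_paired (v := src a)) => //.
by rewrite odd_ordS /= odd_double.
Qed.

Lemma card_even_colors a :
  #|[set k | a \in F k]| = #|[set i | a \in F (dbl i)]|.*2.
Proof.
rewrite card_dbl.
suff -> : #|[set i | a \in F (ordS (dbl i))]| = #|[set i | a \in F (dbl i)]|.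
  by rewrite addnn.
under eq_finset do rewrite odd_color_mem.
case: (black (src a)) => //.
rewrite -[LHS](card_imset _ (@ordS_inj p)); apply: eq_card => i; rewrite [RHS]inE.
apply/imsetP/idP => [[j]|aF]; first by rewrite inE => aF ->.
by exists (ord_pred i); rewrite ?inE ord_predK.
Qed.

Lemma Lambda_reduced : reduced_decomposition u black (Lambda F).
Proof.
have [subF _ forF locF] := schnyderF; split.
- by move=> i; rewrite ffunE.
- move=> a int_a.
  have -> : [set i | a \in edges_of (Lambda F i)] =
      [set i | a \in F (dbl i)] :|: [set i | opp a \in F (dbl i)].
    by apply/setP=> i; rewrite !inE ffunE.
  have := cardsUI [set i | a \in F (dbl i)] [set i | opp a \in F (dbl i)].
  rewrite (_ : _ :&: _ = set0) ?cards0; last first.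
    apply/setP=> i; rewrite !inE; apply/negP=> /andP[/schnyder_opp aF].
    by rewrite (negbTE aF).
  have := card_colors int_a; rewrite !card_even_colors; clear -p_ge2; lia.
- by move=> i; rewrite ffunE.
move=> v int_v; have [e [out_e cw_e between_e]] := locF v int_v.
have src_e k : src (e k) = v := (out_arcs_mem (out_e k)).2.
have pair_e (k : 'I_p.*2) : odd k = black v -> e k = e (ordS k).
  move=> odd_k; have [ek_in _] := out_arcs_mem (out_e k).
  by apply/eqP; rewrite -(mem_out_arcs (out_e _) (src_e k)) -(all_paired (v := v)).
have lt0 : 0 < p by clear -p_ge2; lia.
exists (fun i => e (dbl i)); split.
- by move=> i; rewrite ffunE.
- rewrite (@clockwise_codom _ _ _ v (Ordinal lt0)); last by move=> i; apply: src_e.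
  move: cw_e; rewrite (@clockwise_codom _ _ _ v (dbl (Ordinal lt0))) //.
  (* Skipping the odd colors can only shorten the total turn, by the triangle inequality for
     [findex]. *)
  apply: leq_trans; rewrite sum_dbl; apply: leq_sum => i _.
  rewrite ordS2_dbl; apply: findex_triangle; first exact: cw_inj;
    exact: (fconnect_src (src_e _) (src_e _)).
move=> i a; rewrite ffunE => aF ta; have := between_e _ _ aF ta.
rewrite ord_pred_dbl; case: ifP => black_v.
  rewrite (pair_e (ordS (dbl i))) ?ordS2_dbl; last by rewrite odd_ordS /= odd_double black_v.
  by rewrite (pair_e (ordS (dbl _))) ?ordS2_dbl ?ord_predK // odd_ordS /= odd_double black_v.
by rewrite -!(pair_e (dbl _)) //= odd_double black_v.
Qed.

End EvenSchnyder.

Lemma Lambda_inj F1 F2 :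
  schnyder_decomposition u F1 -> even_decomposition F1 ->
  schnyder_decomposition u F2 -> even_decomposition F2 ->
  @Lambda G p F1 = Lambda F2 -> F1 = F2.
Proof.
move=> s1 e1 s2 e2 /ffunP eqL.
have eq_dbl i : F1 (dbl i) = F2 (dbl i) by have := eqL i; rewrite !ffunE.
apply/ffunP; apply: dbl_cases => [//|i]; apply/setP=> a.
by rewrite !odd_color_mem // eq_dbl.
Qed.

End EvenDecompositions.

(** * Separation by a directed cycle *)

Section ClosedCurve.
Import GRing.Theory Num.Theory.
Variables (G : plane_graph) (A : {set dart G}) (S : {set vertex G}).
Implicit Types (a b x y : dart G) (v w : vertex G).
Hypothesis funA : functional A.
Hypothesis antiA : forall a, a \in A -> opp a \notin A.
Hypothesis intS : S \subset internal_vertices G.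
Hypothesis S_nonempty : S != set0.

Local Notation ind := (findex (@cw G)).
Local Notation out := (arc A).

Definition parent v : vertex G := tgt (out v).

Hypothesis parentS : forall v, v \in S -> parent v \in S.
Hypothesis minS : forall B : {set vertex G}, B \subset S -> B != set0 ->
  (forall v, v \in B -> parent v \in B) -> B = S.

Lemma out_mem v : v \in S -> out v \in A.
Proof. by move/(subsetP intS)/(functional_arc funA) => []. Qed.

Lemma out_src v : v \in S -> src (out v) = v.
Proof. by move/(subsetP intS)/(functional_arc funA) => []. Qed.

(** The image is again closed under [parent], so minimality applies. Hence [parent] permutes [S],
    and each vertex of [S] has exactly one incoming and one outgoing arc of the curve. *)
Lemma parent_imset : parent @: S = S.
Proof.
apply: minS.
- by apply/subsetP=> _ /imsetP[v vS ->]; apply: parentS.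
- have /set0Pn[v vS] := S_nonempty.
  by apply/set0Pn; exists (parent v); apply: imset_f.
by move=> _ /imsetP[v vS ->]; apply/imset_f/parentS.
Qed.

Lemma parent_inj : {in S &, injective parent}.
Proof. by apply/imset_injP; rewrite parent_imset. Qed.

Definition curve : {set dart G} := [set out v | v in S].

Lemma curveP a : a \in curve -> [/\ src a \in S, a = out (src a), a \in A & tgt a \in S].
Proof.
case/imsetP=> v vS ->; rewrite out_src //; split=> //; first exact: out_mem.
exact: parentS.
Qed.

Lemma curve_out v : v \in S -> out v \in curve.
Proof. by move=> vS; apply: imset_f. Qed.

Lemma curve_opp a : a \in curve -> opp a \notin curve.
Proof.
move=> aC; apply/negP=> oC; have [_ _ aA _] := curveP aC.
by have [_ _] := curveP oC; rewrite (negbTE (antiA aA)).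
Qed.

Local Open Scope ring_scope.

Definition curve_flow a : rat := (a \in curve)%:R - (opp a \in curve)%:R.

Lemma curve_flow_div v : \sum_(a | src a == v) curve_flow a = 0.
Proof.
rewrite /curve_flow sumrB; apply/eqP; rewrite subr_eq0; apply/eqP.
transitivity ((v \in S)%:R : rat).
  case: (boolP (v \in S)) => vS; last first.
    rewrite big1 // => a /eqP sa; case: (boolP (a \in curve)) => // /curveP[].
    by rewrite sa (negbTE vS).
  rewrite (bigD1 (out v)) ?out_src //= curve_out // big1 ?addr0 // => a /andP[/eqP sa].
  case: (boolP (a \in curve)) => // /curveP[_ def_a _ _].
  by rewrite {1}def_a sa eqxx.
case: (boolP (v \in S)) => vS; last first.
  rewrite big1 // => a /eqP sa; case: (boolP (opp a \in curve)) => // /curveP[_ _ _].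
  by rewrite /tgt oppK sa (negbTE vS).
have := vS; rewrite -{1}parent_imset => /imsetP[w wS def_v].
rewrite (bigD1 (opp (out w))) ?def_v //= oppK curve_out // big1 ?addr0 //.
move=> a /andP[/eqP sa ne_a].
case: (boolP (opp a \in curve)) => // /curveP[oaS def_a _ _].
case/negP: ne_a; rewrite -[a]oppK def_a; apply/eqP; congr (opp (out _)).
by apply: parent_inj => //; rewrite /parent -def_a /tgt oppK sa.
Qed.

(** [s a] is the value on the face containing [a], so [s] is a winding number: it changes by one
    across the curve and nowhere else. *)
Definition potential (s : dart G -> rat) :=
  (forall a, s (face a) = s a) /\ (forall a, s a - s (opp a) = curve_flow a).

Lemma curve_potential : exists s, potential s.
Proof.
have [||s s_face s_flow] := @flow_is_boundary G curve_flow.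
- by move=> a; rewrite /curve_flow oppK opprB.
- exact: curve_flow_div.
by exists s.
Qed.

Section Potential.
Variable s : dart G -> rat.
Hypothesis pot_s : potential s.

Lemma potential_cw b : s (cw b) = s (opp b).
Proof. by rewrite -[RHS]pot_s.1 /face oppK. Qed.

Lemma potential_off b : b \notin curve -> opp b \notin curve -> s (opp b) = s b.
Proof.
move=> bC oC; apply/esym/eqP; rewrite -subr_eq0 pot_s.2 /curve_flow.
by rewrite (negbTE bC) (negbTE oC) subr0.
Qed.

Lemma off_vertex b : src b \notin S -> b \notin curve /\ opp b \notin curve.
Proof.
move=> bS; split; apply: contra bS => /curveP[] //.
by rewrite /tgt oppK.
Qed.

Lemma potential_opp_off_vertex b : src b \notin S -> s (opp b) = s b.
Proof. by move/off_vertex => [? ?]; apply: potential_off. Qed.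

Lemma potential_vertex a b : src a = src b -> src a \notin S -> s a = s b.
Proof.
move=> sab aS; have ab : fconnect (@cw G) a b by rewrite -src_cw sab.
rewrite -(iter_findex ab); elim: (ind a b) => //= n IHn.
by rewrite potential_cw potential_opp_off_vertex ?src_iter_cw.
Qed.

Lemma potential_out v : v \in S -> s (out v) = s (opp (out v)) + 1.
Proof.
move=> vS; apply/eqP; rewrite addrC -subr_eq pot_s.2 /curve_flow curve_out //.
by rewrite (negbTE (curve_opp (curve_out vS))) subr0.
Qed.

Lemma off_curve_at w b : w \in S -> src b = parent w -> b != out (parent w) ->
  b != opp (out w) -> b \notin curve /\ opp b \notin curve.
Proof.
move=> wS sb ne_out ne_in; split.
  by apply: contra ne_out => /curveP[_ def_b _ _]; rewrite -sb -def_b.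
apply: contra ne_in => /curveP[oS def_b _ _].
rewrite -[b]oppK def_b; apply/eqP; congr (opp (out _)).
by apply: parent_inj => //; rewrite /parent -def_b /tgt oppK sb.
Qed.

Lemma in_neq_out w : w \in S -> opp (out w) != out (parent w).
Proof.
move=> wS; apply: contraNneq (antiA (out_mem wS)) => ->.
exact: out_mem (parentS wS).
Qed.

(** Turning clockwise from the outgoing arc of the curve, no other curve edge is met before the
    incoming one, so the potential remains that of the face reached just after the outgoing arc. *)
Lemma potential_left w n : w \in S ->
  (0 < n <= ind (out (parent w)) (opp (out w)))%N ->
  s (iter n (@cw G) (out (parent w))) = s (opp (out (parent w))).
Proof.
move=> wS; have pS := parentS wS; set x := out (parent w).
have xf : fconnect (@cw G) x (opp (out w)).
  by apply: (@fconnect_src _ _ _ (parent w)); rewrite ?out_src.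
elim: n => // -[_ _|n IHn]; first by rewrite /= potential_cw.
move=> lt_n; rewrite iterS potential_cw -IHn; last by case/andP: lt_n => _ /ltnW h; rewrite h.
set b := iter _ _ x; have sb : src b = parent w by rewrite src_iter_cw out_src.
have lt_deg : (n.+1 < order (@cw G) x)%N.
  by case/andP: lt_n => _ /leq_trans; apply; apply/ltnW/findex_max.
have ind_b : ind x b = n.+1 by rewrite findex_iter.
have [] // := off_curve_at wS sb; last exact: potential_off.
  by apply: contra_eqN ind_b => /eqP ->; rewrite findex0.
by apply: contraTneq lt_n => def_b; rewrite -def_b ind_b ltnn.
Qed.

(** The sector swept from the outgoing edge to the incoming edge joins the faces of the reversed
    arcs; the jump of one across each edge transfers the equality to the arcs themselves. *)
Lemma potential_parent w : w \in S -> s (out (parent w)) = s (out w).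
Proof.
move=> wS; have pS := parentS wS; set x := out (parent w).
have xf : fconnect (@cw G) x (opp (out w)).
  by apply: (@fconnect_src _ _ _ (parent w)); rewrite ?out_src.
rewrite [LHS]potential_out // [RHS]potential_out //; congr (_ + 1).
rewrite -(potential_left (n := ind x (opp (out w))) wS) ?iter_findex //.
by rewrite leqnn andbT lt0n findex_eq0 eq_sym in_neq_out.
Qed.

Lemma potential_right w n : w \in S ->
  (ind (out (parent w)) (opp (out w)) < n < order (@cw G) (out (parent w)))%N ->
  s (iter n (@cw G) (out (parent w))) = s (out w).
Proof.
move=> wS; have pS := parentS wS; set x := out (parent w).
have xf : fconnect (@cw G) x (opp (out w)).
  by apply: (@fconnect_src _ _ _ (parent w)); rewrite ?out_src.
elim: n => // n IHn; rewrite ltnS leq_eqVlt => /andP[/predU1P[<- _|lt_n lt_deg]].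
  by rewrite iterS iter_findex // potential_cw oppK.
rewrite iterS potential_cw -IHn; last by rewrite lt_n ltnW.
set b := iter _ _ x; have sb : src b = parent w by rewrite src_iter_cw out_src.
have ind_b : ind x b = n by rewrite findex_iter // ltnW.
have [] // := off_curve_at wS sb; last exact: potential_off.
  by apply: contraTneq lt_n => def_b; rewrite -ind_b def_b findex0.
by apply: contraTneq lt_n => def_b; rewrite -def_b ind_b ltnn.
Qed.

Lemma potential_curve v w : v \in S -> w \in S -> s (out v) = s (out w).
Proof.
move=> vS wS; pose B := [set z in S | s (out z) == s (out w)].
suff : v \in B by rewrite inE => /andP[_ /eqP].
suff -> : B = S by [].
apply: minS => [||z]; first by apply/subsetP=> z; rewrite inE => /andP[].
  by apply/set0Pn; exists w; rewrite inE wS eqxx.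
by rewrite !inE => /andP[zS /eqP <-]; rewrite parentS // potential_parent // eqxx.
Qed.

(* [c] is the value of the potential on the side by which [B] leaves the curve. *)
Lemma potential_path (B : {set dart G}) c v w :
  (forall a, a \in B -> src a \in S -> a != out (src a) -> s (opp a) = c) ->
  v \in S -> connect (adj B) v w -> w \notin S ->
  forall b, src b = w -> s b = c.
Proof.
move=> leaveB vS con_w wS.
(* The path may come back to [S] and leave it again, always by the same side, hence the
   disjunction. *)
pose P z := z \in S \/ forall b, src b = z -> s b = c.
suff [|//] : P w by rewrite (negbTE wS).
apply: (connect_ind (P := P) con_w) => [|a aB Pa]; first by left.
case: (boolP (tgt a \in S)) => tS; [by left | right => b sb].
have -> : s b = s (opp a) by apply: potential_vertex; rewrite sb.
case: (boolP (src a \in S)) => saS.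
  apply: leaveB => //; apply: contraNneq tS => ->.
  exact: parentS.
rewrite potential_opp_off_vertex //; case: Pa => [|->//].
by rewrite (negbTE saS).
Qed.

End Potential.

(* [B1] leaves the curve to its left and [B2] to its right, but the external face
   lies on one side only. *)
Lemma one_sided_exit (u : nat -> vertex G) (B1 B2 : {set dart G}) :
  external_clockwise u ->
  (forall v, v \in S -> exists j : nat, connect (adj B1) v (u j)) ->
  (forall v, v \in S -> exists j : nat, connect (adj B2) v (u j)) ->
  (forall w a, w \in S -> a \in B1 -> src a = parent w -> a != out (parent w) ->
     (ind (out (parent w)) a < ind (out (parent w)) (opp (out w)))%N) ->
  (forall w a, w \in S -> a \in B2 -> src a = parent w -> a != out (parent w) ->
     (ind (out (parent w)) (opp (out w)) < ind (out (parent w)) a)%N) ->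
  False.
Proof.
move=> cw_u root1 root2 left1 right2.
have [s pot_s] := curve_potential.
have /set0Pn[v0 v0S] := S_nonempty.
have leave (B : {set dart G}) c :
    (forall w a, w \in S -> a \in B -> src a = parent w -> a != out (parent w) ->
       a != opp (out w) /\ s a = c) ->
    (forall v, v \in S -> exists j : nat, connect (adj B) v (u j)) ->
    s (outer G) = c.
  move=> leaveB rootB; have [j con_j] := rootB v0 v0S.
  have [b b_ext sb] := external_contourP cw_u j.
  have -> : s (outer G) = s b.
    move: b_ext; rewrite inE; apply: fconnect_invariant => a /=.
    by rewrite pot_s.1 eqxx.
  apply: (potential_path pot_s _ v0S con_j) sb.
    move=> a aB; rewrite -parent_imset => /imsetP[w wS sa]; rewrite sa => ne_out.
    have [ne_in <-] := leaveB w a wS aB sa ne_out.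
    by have [] := off_curve_at wS sa ne_out ne_in; apply: potential_off.
  by apply: contra (external_not_internal cw_u j) => /(subsetP intS).
have fcon w a : w \in S -> src a = parent w -> fconnect (@cw G) (out (parent w)) a.
  by move=> wS sa; apply: (@fconnect_src _ _ _ (parent w)); rewrite ?out_src ?parentS.
have eq1 : s (outer G) = s (out v0) - 1.
  apply: (leave B1) root1 => w a wS aB sa ne_out.
  have lt_a := left1 w a wS aB sa ne_out; split.
    by apply: contraTneq lt_a => ->; rewrite ltnn.
  rewrite -(iter_findex (fcon w a wS sa)) potential_left //; last first.
    by rewrite lt0n findex_eq0 eq_sym ne_out ltnW.
  rewrite (potential_curve pot_s v0S (parentS wS)) (potential_out pot_s (parentS wS)).
  by rewrite addrK.
have eq2 : s (outer G) = s (out v0).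
  apply: (leave B2) root2 => w a wS aB sa ne_out.
  have lt_a := right2 w a wS aB sa ne_out; split.
    by apply: contraTneq lt_a => ->; rewrite ltnn.
  rewrite -(iter_findex (fcon w a wS sa)) potential_right //.
    exact: potential_curve.
  by rewrite lt_a findex_max // fcon.
move: eq1; rewrite eq2 => /eqP; rewrite -subr_eq0 opprB addrC subrK.
by rewrite oner_eq0.
Qed.

End ClosedCurve.

(** * Unfolding reduced decompositions *)

Section ReducedDecompositions.
Variables (p : nat) (G : plane_graph) (u : nat -> vertex G) (black : pred (vertex G)).
Hypothesis p_ge2 : 2 <= p.
Hypothesis angG : angulation p.*2 G.
Hypothesis girthG : has_girth G p.*2.
Hypothesis clockwise_u : external_clockwise u.
Hypothesis coloring : proper_coloring black.
Hypothesis black_u1 : black (u 1).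
Variable F : {ffun 'I_p -> {set dart G}}.
Hypothesis reducedF : reduced_decomposition u black F.
Implicit Types (a b x y : dart G) (v w : vertex G) (i j : 'I_p) (k : 'I_p.*2).

Lemma reduced_src_internal i a : a \in F i -> src a \in internal_vertices G.
Proof.
case: reducedF => _ _ forF _.
exact: (forest_src_internal angG clockwise_u (forF i)).
Qed.

Lemma reduced_opp i a : a \in F i -> opp a \notin F i.
Proof. by case: reducedF => _ _ /(_ i) [[anti _] _ _] _; apply: anti. Qed.

Definition reduced_color k (c : bool) : 'I_p :=
  if odd k && c then ordS (half_ord k) else half_ord k.

Lemma reduced_color_dbl i c : reduced_color (dbl i) c = i.
Proof. by rewrite /reduced_color /= odd_double half_dbl. Qed.

Lemma reduced_color_odd i c :
  reduced_color (ordS (dbl i)) c = if c then ordS i else i.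
Proof. by rewrite /reduced_color odd_ordS /= odd_double half_ordS_dbl. Qed.

Definition unfolding : {ffun 'I_p.*2 -> {set dart G}} :=
  [ffun k => [set a | a \in F (reduced_color k (black (src a)))]].

Lemma unfolding_dbl i : unfolding (dbl i) = F i.
Proof. by apply/setP=> a; rewrite ffunE inE reduced_color_dbl. Qed.

Lemma unfolding_odd i a : (a \in unfolding (ordS (dbl i))) =
  (a \in F (if black (src a) then ordS i else i)).
Proof. by rewrite ffunE inE reduced_color_odd. Qed.

Lemma unfolding_src_internal k a : a \in unfolding k -> src a \in internal_vertices G.
Proof. by rewrite ffunE inE; apply: reduced_src_internal. Qed.

(** At a black vertex, incoming arcs of color [i] are strictly after the outgoing arc of color
    [ordS i]. This is what keeps the two orientations of an edge out of the same odd color. *)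
Lemma opp_black_color i a : black (src a) -> a \in F (ordS i) -> opp a \notin F i.
Proof.
move=> black_a aF; apply/negP=> oF.
case: reducedF => _ _ _ /(_ _ (reduced_src_internal aF)) [e [out_e _ between_e]].
have := between_e _ _ oF; rewrite /tgt oppK black_a => /(_ erefl) /and4P[].
by rewrite -(mem_out_arcs (out_e (ordS i)) erefl) aF.
Qed.

Lemma unfolding_opp k a : a \in unfolding k -> opp a \notin unfolding k.
Proof.
elim/dbl_cases: k => i; rewrite ?unfolding_dbl; first exact: reduced_opp.
rewrite !unfolding_odd -/(tgt a) (black_tgt coloring).
case: ifP => black_a; first exact: opp_black_color.
move=> aF; apply: contraTN aF; rewrite -{2}[a]oppK; apply: opp_black_color.
by rewrite -/(tgt a) (black_tgt coloring) black_a.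
Qed.

Lemma out_arcs_unfolding v (e : 'I_p -> dart G) :
  (forall i, out_arcs (F i) v = [set e i]) ->
  forall k, out_arcs (unfolding k) v = [set e (reduced_color k (black v))].
Proof.
move=> out_e k; rewrite -out_e; apply/setP=> a; rewrite !inE ffunE inE.
by case: eqP => [->|]; rewrite ?andbF.
Qed.

Lemma unfolding_functional k : functional (unfolding k).
Proof.
move=> v int_v; case: reducedF => _ _ _ /(_ _ int_v) [e [out_e _ _]].
by have out_k := out_arcs_unfolding out_e k; rewrite (arc_out out_k).
Qed.

Lemma reduced_root i v : v \in internal_vertices G ->
  exists j : nat, connect (adj (F i)) v (u j).
Proof.
move=> int_v; case: reducedF => _ _ /(_ i)[_ _ root] _.
have [|j [_ con_j _]] := root v; last by exists j.
by rewrite !(internal_neq_external clockwise_u).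
Qed.

(** Otherwise the vertices reachable from [v] are all internal and closed under [parent]. A minimal
    closed subset is left by [F (ordS i)] and [F i] on opposite sides, although both lead to the
    external face. *)
Lemma unfolding_root_odd i v :
  exists k, connect (adj (unfolding (ordS (dbl i)))) v (u k).
Proof.
set A := unfolding _.
case: (pickP (fun k : 'I_p.*2 => connect (adj A) v (u k))) => [k con_k|no_root].
  by exists k.
have funA : functional A := @unfolding_functional _.
pose closed (B : {set vertex G}) := [&& B != set0, B \subset internal_vertices G
  & [forall w in B, parent A w \in B]].
pose B0 := [set w | connect (adj A) v w].
have B0_closed : closed B0.
  have int_B0 w : connect (adj A) v w -> w \in internal_vertices G.
    apply: contraTT => /(not_internalP angG clockwise_u)[k ->].
    by rewrite no_root.
  apply/and3P; split.
  - by apply/set0Pn; exists v; rewrite inE.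
  - by apply/subsetP=> w; rewrite inE; apply: int_B0.
  apply/forall_inP=> w; rewrite !inE => con_w; apply: (connect_trans con_w).
  have [wA sw] := functional_arc funA (int_B0 w con_w).
  by rewrite -{1}sw; apply: connect_dart.
have [S /minsetP[/and3P[S_n0 intS /forall_inP parentS] minS] _] := minset_exists B0_closed.
have min_S (B : {set vertex G}) : B \subset S -> B != set0 ->
    (forall w, w \in B -> parent A w \in B) -> B = S.
  move=> subB B_n0 clB; apply: minS => //; apply/and3P; split=> //.
    exact: subset_trans intS.
  exact/forall_inP.
have antiA a : a \in A -> opp a \notin A by apply: unfolding_opp.
exfalso.
have int_S w : w \in S -> w \in internal_vertices G by apply/subsetP.
(* The rules for the two vertex colors give the same sector here: at a black parent the arc entering
   has color [i], at a white one color [ordS i], and in both cases it lies between [e (ordS i)] and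
   [e i]. Only the outgoing arc alternates between these two ends. *)
have local w : w \in S -> exists e : 'I_p -> dart G,
    [/\ forall j, out_arcs (F j) (parent A w) = [set e j],
      arc A (parent A w) = e (if black (parent A w) then ordS i else i)
    & strictly_between (e (ordS i)) (opp (arc A w)) (e i)].
  move=> wS; have pS := parentS w wS.
  case: reducedF => _ _ _ /(_ _ (int_S _ pS)) [e [out_e _ between_e]].
  exists e; split=> //.
    by rewrite (arc_out (out_arcs_unfolding out_e _)) reduced_color_odd.
  have [wA sw] := functional_arc funA (int_S w wS).
  move: wA; rewrite unfolding_odd => wF; have := between_e _ _ wF erefl.
  rewrite /parent (black_tgt coloring); case: (black (src _)) => //=.
  by rewrite ordSK.
apply: (one_sided_exit funA antiA intS S_n0 parentS min_S clockwise_u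
  (B1 := F (ordS i)) (B2 := F i)).
- by move=> w /int_S; apply: reduced_root.
- by move=> w /int_S; apply: reduced_root.
- move=> w a wS aF sa; have [e [out_e -> between_e]] := local w wS.
  have src_e j : src (e j) = parent A w := (out_arcs_mem (out_e j)).2.
  move: aF; rewrite (mem_out_arcs (out_e _) sa) => /eqP ->.
  case: ifP => [_|_ ne_e]; first by rewrite eqxx.
  by apply: findex_gt_of_between; rewrite // ?src_e // eq_sym.
move=> w a wS aF sa; have [e [out_e -> between_e]] := local w wS.
have src_e j : src (e j) = parent A w := (out_arcs_mem (out_e j)).2.
move: aF; rewrite (mem_out_arcs (out_e _) sa) => /eqP ->.
case: ifP => [_ ne_e|]; last by rewrite eqxx.
suff /andP[] : 0 < findex (@cw G) (e (ordS i)) (opp (arc A w))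
    < findex (@cw G) (e (ordS i)) (e i) by [].
by apply: findex_lt_of_between; rewrite // ?src_e // eq_sym.
Qed.

Lemma unfolding_forest k : spanning_forest u k (unfolding k).
Proof.
elim/dbl_cases: k => i.
  by rewrite unfolding_dbl; case: reducedF.
apply: (functional_forest angG girthG clockwise_u).
- exact: unfolding_functional.
- exact: unfolding_src_internal.
- exact: unfolding_opp.
- move=> a; rewrite unfolding_odd => aF.
  have col := external_color clockwise_u coloring black_u1.
  (* Of the two external vertices that color [2i+1] must avoid, one is avoided by the forest from
     which the arc is borrowed, and the other has the wrong color to be its target. *)
  have neq k : black (tgt a) != odd k -> tgt a != u k.
    by apply: contraNneq => ->; rewrite col.
  have odd_k : odd (ordS (dbl i)) by rewrite odd_ordS /= odd_double.
  have odd_Sk : odd (ordS (ordS (dbl i))) = false by rewrite odd_ordS odd_k.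
  have forF j : a \in F j -> (tgt a != u (dbl j)) && (tgt a != u (ordS (dbl j))).
    by case: reducedF => _ _ /(_ j)[_ span _] _ /span /andP[].
  move: (black_tgt coloring a) aF; case: ifP => black_a tgt_a /forF /andP[h1 h2].
    by rewrite neq ?tgt_a ?odd_k // ordS2_dbl.
  by rewrite h2 neq // tgt_a odd_Sk.
exact: unfolding_root_odd.
Qed.

Lemma card_unfolding_colors a :
  #|[set k | a \in unfolding k]| = #|[set i | a \in F i]|.*2.
Proof.
rewrite card_dbl; under eq_finset do rewrite unfolding_dbl.
suff -> : #|[set i | a \in unfolding (ordS (dbl i))]| = #|[set i | a \in F i]|.
  by rewrite addnn.
under eq_finset do rewrite unfolding_odd.
case: (black (src a)) => //.
rewrite -[LHS](card_imset _ (@ordS_inj p)); apply: eq_card => i; rewrite [RHS]inE.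
apply/imsetP/idP => [[j]|aF]; first by rewrite inE => aF ->.
by exists (ord_pred i); rewrite ?inE ord_predK.
Qed.

Lemma unfolding_schnyder : schnyder_decomposition u unfolding.
Proof.
have [subF cardF _ locF] := reducedF; split.
- move=> k; apply/subsetP=> a; rewrite ffunE inE; exact/subsetP/subF.
- move=> a int_a.
  have disjoint_card n (K : 'I_n -> {set dart G}) :
      (forall l, a \in K l -> opp a \notin K l) ->
      #|[set l | a \in edges_of (K l)]| =
      #|[set l | a \in K l]| + #|[set l | opp a \in K l]|.
    move=> antiK; rewrite -cardsUI (_ : _ :&: _ = set0) ?cards0 ?addn0.
      by apply: eq_card => l; rewrite !inE.
    apply/setP=> l; rewrite !inE; apply/negP=> /andP[/antiK aK].
    by rewrite (negbTE aK).
  rewrite disjoint_card; last by move=> l; apply: unfolding_opp.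
  have := cardF a int_a; rewrite disjoint_card; last by move=> l; apply: reduced_opp.
  by rewrite !card_unfolding_colors; clear -p_ge2; lia.
- exact: unfolding_forest.
move=> v int_v; have [e [out_e cw_e between_e]] := locF v int_v.
have src_e i : src (e i) = v := (out_arcs_mem (out_e i)).2.
have lt0 : 0 < p by clear -p_ge2; lia.
exists (fun k => e (reduced_color k (black v))); split.
- exact: out_arcs_unfolding.
- rewrite (@clockwise_codom _ _ _ v (dbl (Ordinal lt0))); last by move=> k; apply: src_e.
  move: cw_e; rewrite (@clockwise_codom _ _ _ v (Ordinal lt0)) // reduced_color_dbl.
  (* Each odd color repeats one of its two neighbors, so inserting it adds a null turn. *)
  apply: leq_trans; rewrite sum_dbl; apply: leq_sum => i _.
  rewrite ordS2_dbl !reduced_color_dbl reduced_color_odd.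
  by case: (black v); rewrite findex0 ?addn0.
elim/dbl_cases => i a.
  rewrite unfolding_dbl ord_pred_dbl !reduced_color_odd ord_predK => aF ta.
  by have := between_e _ _ aF ta; case: (black v).
rewrite unfolding_odd ordS2_dbl ordSK !reduced_color_dbl => aF ta.
have := between_e _ _ aF ta; rewrite -ta (black_tgt coloring).
by case: (black (src a)) aF => //= aF; rewrite ordSK.
Qed.

Lemma unfolding_even : even_decomposition unfolding.
Proof. by move=> a _; rewrite card_unfolding_colors odd_double. Qed.

Lemma Lambda_unfolding : Lambda unfolding = F.
Proof. by apply/ffunP=> i; rewrite ffunE unfolding_dbl. Qed.

End ReducedDecompositions.

From mathcomp Require Import classical_sets functions.

Theorem theorem5p3 (p : nat) (hp : 2 <= p) (G : plane_graph)
    (hG : angulation p.*2 G) (hgirth : has_girth G p.*2)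
    (u : nat -> vertex G) (hu : external_clockwise u)
    (black : pred (vertex G)) (hcol : proper_coloring black) (hu1 : black (u 1)) :
  set_bij
    [set F : {ffun 'I_p.*2 -> {set dart G}} |
       schnyder_decomposition u F /\ even_decomposition F]%classic
    [set F' : {ffun 'I_p -> {set dart G}} | reduced_decomposition u black F']%classic
    (@Lambda G p).
Proof.
split.
- move=> F [schF evF] /=.
  exact: (Lambda_reduced hp hG hu hcol hu1 schF evF).
- move=> F1 F2 /set_mem[s1 e1] /set_mem[s2 e2].
  exact: (Lambda_inj hp hG hu hcol hu1 s1 e1 s2 e2).
move=> F' redF' /=; exists (unfolding black F').
  split; first exact: (unfolding_schnyder hp hG hgirth hu hcol hu1 redF').
  exact: unfolding_even.
exact: Lambda_unfolding.
Qed.
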